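(* There is an online fractional marking algorithm for Caching with Reserves, namely the fractional marking algorithm $\mathcal A$ described in the context, that is $O(\log k)$-competitive, even when the optimal offline algorithm is allowed to hold fractional pages in the cache. That is, there is an absolute constant $C$ such that for every choice of $m,k,\{\mathcal P(i)\},\{k_i\}$ there is a constant $b$, independent of the number of page requests, such that for every request sequence, with $\sigma$ the resulting instance, $$\mathrm{cost}_{\mathcal A}(\sigma)\le C\ln(1+k)\cdot \mathrm{cost}_{OPT}(\sigma)+b,$$ where $\mathrm{cost}_{OPT}(\sigma)$ is the minimum cost of an offline fractional solution for $\sigma$.
   Context: Caching with Reserves. An instance $\sigma$ consists of agents $[m]=\{1,\dots,m\}$, an integer cache size $k$, pairwise disjoint finite page sets $\mathcal P(i)$, $i\in[m]$, with $\mathcal P=\bigcup_i\mathcal P(i)$ (pages of $\mathcal P(i)$ are called $i$-pages), integer reserves $k_i\ge 0$ with $\sum_i k_i<k$, and a sequence of requested pages $p_1,p_2,\dots\in\mathcal P$; $i_t$ denotes the agent owning $p_t$. A fractional algorithm maintains $x_p\in[0,1]$ for all $p\in\mathcal P$ (the portion of $p$ in cache) with $\sum_{p\in\mathcal P}x_p\le k$ and $\sum_{p\in\mathcal P(i)}x_p\ge k_i$ for all $i$; write $y_p=1-x_p$. When $p_t$ is requested it pays $1-x_{p_t}$ (value just before the request) and must set $x_{p_t}=1$. The cost is the total paid. An online algorithm sees $p_t$ only at time $t$; an offline one knows the whole sequence. Fractional marking algorithm $\mathcal A$. It maintains $\sum_{p}y_p=|\mathcal P|-k$. Initially the cache holds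 $k$ pages integrally; $P(i,0)$ is the set of $i$-pages among them, with $|P(i,0)|\ge k_i$. Initially all agents are non-isolated, no page is marked, the global phase counter is $r_0=1$ and the local phase counters are $r_i=1$, $i\in[m]$. At any time, agent $i$ is tight if $\sum_{p\in\mathcal P(i)}x_p=k_i$ and non-tight if this sum is $>k_i$; the unmarked $i$-pages are the pages of $P(i,r_i-1)$ that are not marked. On request $p_t$: (1) If $y_{p_t}=0$, mark $p_t$. (2) Else, if $i_t$ is isolated: set $y_{p_t}=0$, mark $p_t$, and increase $y_q$ at the same rate for all unmarked $i_t$-pages $q$ in the cache until $\sum_p y_p=|\mathcal P|-k$. If $i_t$ now has $k_{i_t}$ marked pages, it becomes non-isolated. (3) Else, if there is an unmarked page $q$ with $y_q<1$ owned by a non-tight agent (here $i_t$ counts as non-tight): set $y_{p_t}=0$, mark $p_t$, and continuously increase, at the same rate, $y_q$ for those unmarked pages $q$ with $y_q<1$ of currently non-tight agents that have the smallest $y$-value, until $\sum_p y_p=|\mathcal P|-k$ (an agent that becomes tight in the process drops out). (4) Else, the current global phase ends: every agent $i$ with strictly fewer than $k_i$ marked pages is designated isolated (keeping its marks and $r_i$); for every other agent $i$, which is non-isolated, let $P(i,r_i)$ be the set of all (integral and marked) $i$-pages in cache, increase $r_i$ by 1, and unmark all $i$-pages. Then increase $r_0$ by 1 and re-process $p_t$ in the new phase.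
   Formalization: An isolated agent reaching its reserve of marked pages becomes non-isolated also on a hit (case 1), else case (2) may have no page to evict; and in any fractional solution only the requested page may gain cache portion, else offline prefetching would be free and the optimum 0. *)

(* Defs.v *)
From mathcomp Require Import all_boot all_order all_algebra.
#[warnings="-notation-incompatible-prefix,-notation-overridden"]
From mathcomp Require Import all_classical all_reals all_analysis.

Set Implicit Arguments.
Unset Strict Implicit.
Unset Printing Implicit Defensive.

Import Order.TTheory GRing.Theory Num.Theory.

Local Open Scope ring_scope.

(** * Caching with Reserves *)

(** The page set of agent [i] is the fibre of [owner] over [i], so the page
    sets of distinct agents are disjoint by construction. *)
Record setting := Setting {
  agents : nat;
  page : finType;
  owner : page -> 'I_agents;
  cache_size : nat;
  reserve : 'I_agents -> nat;
  reserve_lt : (\sum_i reserve i < cache_size)%N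
}.

Section Solutions.
Context {R : realType} {S : setting}.
Implicit Types (x : {ffun page S -> R}) (i : 'I_(agents S)).

Definition feasible x : Prop :=
  [/\ forall p, 0 <= x p <= 1,
      \sum_p x p <= (cache_size S)%:R
    & forall i, (reserve i)%:R <= \sum_(p | owner p == i) x p].

(** [X 0] is the initial cache, which is not prescribed, and [X t.+1] is the
    cache after the [t]-th request (counted from 0).  Only the requested page is
    paid for, so no other page may gain any portion of the cache. *)
Definition solution n (sigma : n.-tuple (page S))
    (X : nat -> {ffun page S -> R}) : Prop :=
  (forall t, (t <= n)%N -> feasible (X t)) /\
  (forall t : 'I_n, X t.+1 (tnth sigma t) = 1 /\
     forall q, q != tnth sigma t -> X t.+1 q <= X t q).

Definition cost n (sigma : n.-tuple (page S))
    (X : nat -> {ffun page S -> R}) : R :=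
  \sum_(t < n) (1 - X t (tnth sigma t)).

(** [cost] is linear and the solutions of a given [sigma] form a nonempty
    compact polytope (up to the irrelevant values after time [n]) whenever the
    setting admits a feasible cache, so the infimum is attained. *)
Definition cost_OPT n (sigma : n.-tuple (page S)) : R :=
  inf [set c | exists2 X, solution sigma X & c = cost sigma X]%classic.

(** An online algorithm maps the requests seen so far to its cache. *)
Definition online_run (alg : seq (page S) -> {ffun page S -> R})
    n (sigma : n.-tuple (page S)) : nat -> {ffun page S -> R} :=
  fun t => alg (take t sigma).

End Solutions.

(** * Continuous increase at equal rates

    [flow E y z]: starting from [y], the values of the pages in the active set,
    which is [E] of the current vector, grow at unit rate until [z] is reached.
    The active set is constant on each of finitely many time intervals
    [[0, d)]. *)
Section Flow.
Context {R : realType} {P : finType}.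
Implicit Types (y z : {ffun P -> R}) (A : {set P}).

Definition raise A (d : R) y : {ffun P -> R} :=
  [ffun q => if q \in A then y q + d else y q].

Inductive flow (E : {ffun P -> R} -> {set P}) (y z : {ffun P -> R}) : Prop :=
| flow_stop of y = z
| flow_step (d : R) of 0 <= d &
    (forall s, 0 <= s < d -> E (raise (E y) s y) = E y) &
    flow E (raise (E y) d y) z.

End Flow.

(** * The fractional marking algorithm *)

(** [snap i r] is P(i, r); [phase i] is the local phase counter r_i and
    [gphase] the global one r_0. *)
Record state (R : realType) (S : setting) := State {
  yval : {ffun page S -> R};
  marked : {set page S};
  isolated : {set 'I_(agents S)};
  snap : 'I_(agents S) -> nat -> {set page S};
  phase : 'I_(agents S) -> nat;
  gphase : nat
}.

Section Algorithm.
Context {R : realType} {S : setting}.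
Implicit Types (s : state R S) (y z : {ffun page S -> R}).
Implicit Types (p q : page S) (i : 'I_(agents S)).

Definition initial_cache (C0 : {set page S}) : Prop :=
  #|C0| = cache_size S /\
  forall i, (reserve i <= #|[set p in C0 | owner p == i]|)%N.

Definition init (C0 : {set page S}) : state R S :=
  {| yval := [ffun p => if p \in C0 then 0 else 1];
     marked := finset.set0;
     isolated := finset.set0;
     snap := fun i _ => [set p in C0 | owner p == i];
     phase := fun=> 1%N;
     gphase := 1 |}.

Definition marked_of s i : {set page S} := [set p in marked s | owner p == i].

Definition unmarked s : {set page S} :=
  [set q | (q \in snap s (owner q) (phase s (owner q)).-1)
           && (q \notin marked s)].

Definition non_tight y i : bool :=
  (reserve i)%:R < \sum_(p | owner p == i) (1 - y p).

(** An isolated agent that reaches its reserve of marked pages becomes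
    non-isolated, also when the last of them is marked on a hit. *)
Definition mark s p : state R S :=
  let M := p |: marked s in
  let i := owner p in
  {| yval := yval s;
     marked := M;
     isolated := if #|[set q in M | owner q == i]| == reserve i
                 then isolated s :\ i else isolated s;
     snap := snap s;
     phase := phase s;
     gphase := gphase s |}.

Definition set_y s y : state R S :=
  {| yval := y; marked := marked s; isolated := isolated s;
     snap := snap s; phase := phase s; gphase := gphase s |}.

Definition load y p : {ffun page S -> R} :=
  [ffun q => if q == p then 0 else y q].

(** Follows the flow until the total is |P| - k.  If no such point existed, the
    result would be [y] itself. *)
Definition rebalance (E : {ffun page S -> R} -> {set page S}) y :
    {ffun page S -> R} :=
  xget y [set z | flow E y z /\
                  \sum_q z q = #|page S|%:R - (cache_size S)%:R]%classic.

Definition active_own s i y : {set page S} :=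
  [set q in unmarked s | (owner q == i) && (y q < 1)].

Definition evictable s y : {set page S} :=
  [set q in unmarked s | (y q < 1) && non_tight y (owner q)].

Definition active_min s y : {set page S} :=
  [set q in evictable s y | [forall q' in evictable s y, y q <= y q']].

(** None of the cases (hit, isolated owner, evictable page) applies.  The test
    precedes the loading of [p], and there the owner of [p] counts as
    non-tight. *)
Definition phase_over s p : bool :=
  [&& yval s p != 0, owner p \notin isolated s &
      [forall q in unmarked s,
         ~~ ((yval s q < 1)
             && ((owner q == owner p) || non_tight (yval s) (owner q)))]].

Definition end_phase s : state R S :=
  let I := [set i | #|marked_of s i| < reserve i]%N in
  {| yval := yval s;
     marked := [set p in marked s | owner p \in I];
     isolated := I;
     snap := fun i r => if (i \notin I) && (r == phase s i)
                        then [set p | (owner p == i) && (yval s p < 1)]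
                        else snap s i r;
     phase := fun i => if i \in I then phase s i else (phase s i).+1;
     gphase := (gphase s).+1 |}.

Definition serve s p : state R S :=
  let s' := mark s p in
  if yval s p == 0 then s'
  else if owner p \in isolated s then
    set_y s' (rebalance (active_own s' (owner p)) (load (yval s) p))
  else
    set_y s' (rebalance (active_min s') (load (yval s) p)).

Definition step s p : state R S :=
  serve (if phase_over s p then end_phase s else s) p.

Definition marking_algorithm (C0 : {set page S}) (h : seq (page S)) :
    {ffun page S -> R} :=
  [ffun p => 1 - yval (foldl step (init C0) h) p].

End Algorithm.

(* Main.v *)
Require Import Defs.
From mathcomp Require Import all_boot all_order all_algebra.
From mathcomp Require Import all_classical all_reals all_analysis.
From mathcomp Require Import ring lra zify.

(** Upper bound: the unmarked pages carry the entropy-like potential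
    [Phi = sum (y - y ln y)].  A request to a page with [0 < y < 1] only raises
    pages that are at least as far out of the cache, so the fall of [Phi] pays
    for it.  A request to a page with [y = 1] spreads one unit over at most [k]
    pages and raises [Phi] by at most [1 + ln k].  Hence the cost is at most
    [2 + ln k] times the number of full misses.

    Lower bound: against any offline solution [X] the full misses are counted by
    a second potential [Psi], linear in [X], with a different weight for the
    pages of each agent according to whether the agent is isolated, has left
    isolation during the current phase, or neither.  When a phase ends, the
    marked pages of the non-isolated agents and the reserves of the isolated
    ones add up to [k]; as [X] holds at most [k] in total and at least the
    reserve of each agent, [Psi] does not grow. *)

Set Implicit Arguments.
Unset Strict Implicit.
Unset Printing Implicit Defensive.

Import Order.TTheory GRing.Theory Num.Theory.
Local Open Scope ring_scope.

(* Shadowed by the isolated points of the topology library. *)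
Local Notation isolated := Defs.isolated.

(** * The entropy function and elementary real estimates *)

Section Entropy.
Context {R : realType}.
Implicit Types c x y z : R.

(** Its derivative is [- ln x], so a page closer to leaving the cache gains potential more slowly
    when it is raised. *)
Definition phi x : R := x * (1 - ln x).

Lemma phi0 : phi 0 = 0. Proof. by rewrite /phi mul0r. Qed.

Lemma phi_ge0 x : 0 <= x <= 1 -> 0 <= phi x.
Proof.
case/andP=> x0 x1; rewrite /phi mulr_ge0 // subr_ge0.
by rewrite (le_trans (ln_le0 x1)).
Qed.

(** The right side is the tangent at [c] of the concave function [phi]; the bound reduces to
    [ln (1 + u) <= u] at [u = c / z - 1]. *)
Lemma phi_tangent c z : 0 < c -> 0 <= z -> phi z <= c - z * ln c.
Proof.
move=> c0; rewrite le_eqVlt => /predU1P[<-|z0].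
  by rewrite phi0 mul0r subr0 ltW.
have cz : -1 < c / z - 1 by rewrite ltrBrDl subrr divr_gt0.
have := le_ln1Dx cz; rewrite addrC subrK ln_div ?posrE // => H.
have := ler_wpM2l (ltW z0) H.
rewrite /phi mulrBr mulrBr mulr1 [z * (c / z)]mulrCA divff ?gt_eqF // mulr1.
lra.
Qed.

Lemma phi_increment y z : 0 < y -> y <= z -> phi z - phi y <= (z - y) * - ln y.
Proof.
move=> y0 yz; have := phi_tangent y0 (ltW (lt_le_trans y0 yz)); rewrite /phi.
lra.
Qed.

(** The slope of [phi] blows up at 0. Above [1 / N] it is at most [ln N]; below, the tangent at
    [1 / N] is used, at the price of its intercept [1 / N], which sums to at most 1 over [N]
    pages. *)
Lemma phi_increment_unif (N : nat) y z : (0 < N)%N -> 0 <= y -> y <= z ->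
  phi z - phi y <= (z - y) * ln N%:R + N%:R^-1.
Proof.
move=> N0 y0 yz.
have n0 : 0 < N%:R :> R by rewrite ltr0n.
have i0 : 0 < N%:R^-1 :> R by rewrite invr_gt0.
have lnE : ln N%:R^-1 = - ln N%:R :> R by rewrite lnV ?posrE.
have [ge|lt] := leP N%:R^-1 y.
  have y_gt0 : 0 < y by exact: lt_le_trans ge.
  apply: (le_trans (phi_increment y_gt0 yz)).
  have : ln N%:R^-1 <= ln y by rewrite ler_ln ?posrE.
  rewrite lnE => H.
  have : (z - y) * - ln y <= (z - y) * ln N%:R.
    by apply: ler_wpM2l; [rewrite subr_ge0 | rewrite lerNl].
  lra.
have := phi_tangent i0 (le_trans y0 yz); rewrite lnE => Hz.
suff : y * ln N%:R <= phi y by lra.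
move: y0; rewrite le_eqVlt => /predU1P[<-|y0]; first by rewrite phi0 mul0r.
have : ln y <= ln N%:R^-1 by rewrite ler_ln ?posrE // ltW.
rewrite lnE => H; rewrite /phi ler_wpM2l ?(ltW y0) //; lra.
Qed.

(** A flow step controls the active set only on [[0, d)]; this carries affine bounds over to the
    endpoint [d]. *)
Lemma le_slope_limit (a b c d : R) : 0 <= c -> a <= b ->
  (forall s, 0 <= s < d -> a + s * c <= b) -> a + d * c <= b.
Proof.
move=> c0 ab H; rewrite leNgt; apply/negP => lt.
have c_gt0 : 0 < c by rewrite lt_neqAle c0 andbT; apply/eqP => c_eq0; subst c; lra.
(* Midpoint between the time at which the line reaches [b] and [d]; there the bound already
   fails. *)
pose s := ((b - a) / c + d) / 2.
have e : (b - a) / c * c = b - a by rewrite divfK ?gt_eqF.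
have bd : (b - a) / c < d by rewrite ltr_pdivrMr //; lra.
have b0 : 0 <= (b - a) / c by rewrite divr_ge0 //; lra.
have /H : 0 <= s < d by rewrite /s; lra.
by rewrite /s; nra.
Qed.

Lemma seq_min_ex (l : seq R) x :
  exists2 d, d \in x :: l & forall e, e \in x :: l -> d <= e.
Proof.
elim: l x => [|a l IH] x.
  by exists x => [|e]; rewrite inE // => /eqP->.
have [d dl dmin] := IH a; have [xd|dx] := leP x d.
  exists x => [|e]; rewrite inE ?eqxx // => /predU1P[->//|/dmin].
  exact: le_trans.
exists d => [|e]; rewrite inE ?dl ?orbT // => /predU1P[->|/dmin//].
exact: ltW.
Qed.

End Entropy.

(** * Induction along a flow *)

Section FlowTheory.
Context {R : realType} {P : finType}.
Implicit Types (y z : {ffun P -> R}) (A : {set P}).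

Lemma flow_invariant (E : {ffun P -> R} -> {set P}) (Q : {ffun P -> R} -> Prop) :
  (forall y d, Q y -> 0 <= d ->
     (forall s, 0 <= s < d -> E (raise (E y) s y) = E y) ->
     Q (raise (E y) d y)) ->
  forall y z, flow E y z -> Q y -> Q z.
Proof.
move=> step y z; elim=> {y z} [y z ->//|y z d d0 cst _ IH Qy].
by apply: IH; apply: step.
Qed.

Lemma sum_raise A d y (B : pred P) :
  \sum_(q | B q) raise A d y q = \sum_(q | B q) y q + d * #|[set q in A | B q]|%:R.
Proof.
rewrite (eq_bigr (fun q => y q + (if q \in A then d else 0))); last first.
  by move=> q _; rewrite ffunE; case: ifP; rewrite ?addr0.
rewrite big_split /=; congr (_ + _).
rewrite -big_mkcondr /= sumr_const mulr_natr; congr (d *+ _).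
by apply: eq_card => q; rewrite !inE andbC.
Qed.

End FlowTheory.

(** * The amount of cache held by each agent *)

Section Mass.
Context {R : realType} {S : setting}.
Implicit Types (y z : {ffun page S -> R}) (A : {set page S}).
Implicit Types (p q : page S) (i j : 'I_(agents S)).

Definition mass y j : R := \sum_(p | owner p == j) (1 - y p).

Lemma non_tightE y j : non_tight y j = ((reserve j)%:R < mass y j).
Proof. by []. Qed.

Lemma mass_raise A d y j :
  mass (raise A d y) j = mass y j - d * #|[set q in A | owner q == j]|%:R.
Proof. by rewrite /mass !sumrB sum_raise; ring. Qed.

Lemma le_mass y z j : (forall q, owner q = j -> y q <= z q) -> mass z j <= mass y j.
Proof. by move=> H; apply: ler_sum => q /eqP /H; lra. Qed.

Lemma eq_mass y z j : (forall q, owner q = j -> y q = z q) -> mass y j = mass z j.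
Proof. by move=> H; apply: eq_bigr => q /eqP /H ->. Qed.

Lemma non_tight_le y z j : (forall q, y q <= z q) -> non_tight z j -> non_tight y j.
Proof.
by move=> H; rewrite !non_tightE => /lt_le_trans; apply; apply: le_mass => q _.
Qed.

Lemma sum_mass y : \sum_j mass y j = #|page S|%:R - \sum_q y q.
Proof.
rewrite (exchange_big_dep xpredT) //=.
rewrite (eq_bigr (fun q => 1 - y q)); last first.
  by move=> q _; rewrite (big_pred1 (owner q)) // => j; exact: eq_sym.
by rewrite sumrB sumr_const.
Qed.

Lemma mass_split A y j : mass y j =
  \sum_(q in A | owner q == j) (1 - y q) +
  \sum_(q | (q \notin A) && (owner q == j)) (1 - y q).
Proof.
by rewrite /mass (bigID (mem A)) /=; congr (_ + _); apply: eq_bigl => q;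
  rewrite andbC.
Qed.

Lemma mass_zero_on A y j : (forall q, q \in A -> y q = 0) ->
  mass y j = #|[set q in A | owner q == j]|%:R +
             \sum_(q | (q \notin A) && (owner q == j)) (1 - y q).
Proof.
move=> A0; rewrite (mass_split A); congr (_ + _).
rewrite (eq_bigr (fun=> 1)); last by move=> q /andP[/A0-> _]; rewrite subr0.
by rewrite sumr_const; congr (_ %:R); apply: eq_card => q; rewrite !inE.
Qed.

(** Source of integrality: applied with [A] the marked pages, for an agent that holds nothing
    else. *)
Lemma mass_zero_on_exact A y j : (forall q, q \in A -> y q = 0) ->
  (forall q, q \notin A -> owner q = j -> y q = 1) ->
  mass y j = #|[set q in A | owner q == j]|%:R.
Proof.
move=> A0 A1; rewrite (mass_zero_on _ A0) big1 ?addr0 // => q /andP[qA /eqP qj].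
by rewrite (A1 q qA qj) subrr.
Qed.

Lemma mass_zero_on_ge A y j q : (forall q, q \in A -> y q = 0) ->
  (forall q, y q <= 1) -> q \notin A -> owner q = j ->
  #|[set q in A | owner q == j]|%:R + (1 - y q) <= mass y j.
Proof.
move=> A0 y1 qA qj; rewrite (mass_zero_on _ A0) lerD2l (bigD1 q) /=; last first.
  by rewrite qA qj eqxx.
by rewrite lerDl sumr_ge0 // => q' _; rewrite subr_ge0.
Qed.

End Mass.

(** * The flows *)

Section FlowBounds.
Context {R : realType} {P : finType}.
Implicit Types (y z : {ffun P -> R}) (E : {ffun P -> R} -> {set P}).

Lemma raise_ge A (d : R) y q : 0 <= d -> y q <= raise A d y q.
Proof. by move=> d0; rewrite ffunE; case: ifP => // _; rewrite lerDl. Qed.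

Lemma raise_le1 E (d : R) y q : (forall y q, q \in E y -> y q < 1) ->
  (forall s, 0 <= s < d -> E (raise (E y) s y) = E y) ->
  y q <= 1 -> raise (E y) d y q <= 1.
Proof.
move=> E1 cst y1; rewrite ffunE; case: ifP => // qE.
rewrite -[d]mulr1; apply: le_slope_limit => // s sd; rewrite mulr1.
have : q \in E (raise (E y) s y) by rewrite cst.
by move/E1; rewrite ffunE qE => /ltW.
Qed.

End FlowBounds.

Section Flows.
Context {R : realType} {S : setting}.
Implicit Types (y z : {ffun page S -> R}) (A : {set page S}).
Implicit Types (p q : page S) (i j : 'I_(agents S)).
Variable s : state R S.
Notation U := (unmarked s).

(** Unmarked pages of one agent start a phase equal and are always raised together, so each agent
    has a single level. *)
Definition levelled y := forall q q', q \in U -> q' \in U ->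
  owner q = owner q' -> y q = y q'.

Definition flow_between (y0 y : {ffun page S -> R}) :=
  forall q, y0 q <= y q <= 1.

Lemma in_active_own i y q :
  (q \in active_own s i y) = [&& q \in U, owner q == i & y q < 1].
Proof. by rewrite inE. Qed.

Lemma own_flow i y0 z : flow (active_own s i) y0 z ->
  (forall q, y0 q <= 1) -> levelled y0 ->
  [/\ flow_between y0 z, levelled z &
      forall q, z q != y0 q -> [/\ q \in U, owner q = i & y0 q < 1]].
Proof.
move=> fl y1 lev0.
apply: (flow_invariant _ fl (Q := fun y => [/\ flow_between y0 y, levelled y &
  forall q, y q != y0 q -> [/\ q \in U, owner q = i & y0 q < 1]])); last first.
  by split=> // q; rewrite ?lexx ?y1 ?eqxx.
move=> y d [bd lev ch] d0 cst; split.
- move=> q; have /andP[b1 b2] := bd q.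
  rewrite (le_trans b1 (raise_ge _ _ _ d0)) /=.
  by apply: raise_le1 => // y' q'; rewrite inE => /andP[_ /andP[]].
- move=> q q' qU q'U e; have e2 := lev _ _ qU q'U e.
  by rewrite !ffunE !in_active_own qU q'U e e2.
- move=> q; rewrite ffunE; case: ifP => [|_ /ch //].
  rewrite in_active_own => /and3P[qU /eqP qi q1] _; split=> //.
  by have /andP[/le_lt_trans-> //] := bd q.
Qed.

(** All unmarked pages of [i] share one level, so the active set is constant and a single step
    reaches [T]. The upper bound on [T] is what these pages can still give up. *)
Lemma own_flow_ex i y0 (T : R) : levelled y0 -> (forall q, y0 q <= 1) ->
  \sum_q y0 q <= T <= \sum_q y0 q + \sum_(q in U | owner q == i) (1 - y0 q) ->
  exists z, flow (active_own s i) y0 z /\ \sum_q z q = T.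
Proof.
move=> lev y1 /andP[]; rewrite le_eqVlt => /predU1P[<- _|lt le].
  by exists y0; split=> //; apply: flow_stop.
have [q0 /andP[q0U /eqP q0i] q01] :
    exists2 q, (q \in U) && (owner q == i) & y0 q < 1.
  have [//|N] := pselect (exists2 q, (q \in U) && (owner q == i) & y0 q < 1).
  exfalso; move: lt; rewrite ltNge => /negP; apply; rewrite (le_trans le) //.
  rewrite gerDl big1 // => q qUi; apply/eqP; rewrite subr_eq0 eq_sym eq_le y1 /=.
  by rewrite leNgt; apply/negP => q1; apply: N; exists q; [exact: qUi | exact: q1].
pose A := active_own s i y0.
have inA q : (q \in A) = (q \in U) && (owner q == i).
  rewrite in_active_own andbA; case: (boolP ((q \in U) && _)) => //= /andP[qU /eqP qi].
  by rewrite (lev _ _ qU q0U) // qi q0i.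
have A0 : 0 < #|A|%:R :> R.
  by rewrite ltr0n; apply/card_gt0P; exists q0; rewrite inA q0U q0i eqxx.
(* The deficit, shared equally by the active pages. *)
pose d := (T - \sum_q y0 q) / #|A|%:R.
have dA : d * #|A|%:R = T - \sum_q y0 q by rewrite divfK ?gt_eqF.
have d1 : d <= 1 - y0 q0.
  rewrite -(ler_pM2r A0) dA; rewrite -lerBlDl in le; apply: (le_trans le).
  rewrite (eq_bigr (fun=> 1 - y0 q0)).
    rewrite sumr_const mulr_natr (_ : #|_| = #|A|) //; apply: eq_card => q.
    by rewrite inA unfold_in.
  by move=> q /andP[qU /eqP qi]; rewrite (lev _ _ qU q0U) // qi q0i.
exists (raise A d y0); split.
  apply: (@flow_step _ _ _ _ _ d); last exact: flow_stop.
    by rewrite /d divr_ge0 ?ltW // subr_gt0.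
  move=> e /andP[e0 ed]; apply/setP => q; rewrite -/A in_active_own ffunE inA.
  case: (boolP (q \in U)) => //= qU; case: (boolP (owner q == i)) => //= /eqP qi.
  by rewrite (lev _ _ qU q0U) ?qi ?q0i //; lra.
rewrite (sum_raise A d y0 xpredT).
rewrite (_ : #|_| = #|A|); first by rewrite dA; ring.
by apply: eq_card => q; rewrite !inE andbT.
Qed.

Lemma active_minP y q : reflect
  (q \in evictable s y /\ forall q', q' \in evictable s y -> y q <= y q')
  (q \in active_min s y).
Proof.
rewrite /active_min inE; apply: (iffP andP) => -[qe H]; split=> //.
  by move=> q' q'e; move/forall_inP: H; apply.
by apply/forall_inP.
Qed.

Lemma evictableP y q : reflect [/\ q \in U, y q < 1 & non_tight y (owner q)]
  (q \in evictable s y).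
Proof. by rewrite [q \in evictable _ _]inE; apply: and3P. Qed.

Lemma active_min_level y q q' :
  q \in active_min s y -> q' \in active_min s y -> y q = y q'.
Proof.
move=> /active_minP[q1 q2] /active_minP[q'1 q'2].
by apply/le_anti; rewrite q2 // q'2.
Qed.

(** * The flow that raises the lowest evictable pages *)

Section MinFlow.
Variables (y0 : {ffun page S -> R}) (i : 'I_(agents S)).
(** Later the agents that neither are isolated nor have left isolation in this phase. Only their
    levels are known to be lowest among the non-tight agents. *)
Variable fresh : pred 'I_(agents S).
Hypothesis y0_le1 : forall q, y0 q <= 1.
Hypothesis y0_mass : forall j, (reserve j)%:R <= mass y0 j.
Hypothesis y0_lev : levelled y0.
Hypothesis y0_ordered : forall q q', q \in U -> q' \in U -> fresh (owner q) ->
  owner q' <> i -> non_tight y0 (owner q') -> y0 q <= y0 q'.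

(* The requesting agent [i] has just become non-tight and may sit below the
   common level of the other non-tight agents; until it catches up, it is the
   only one to give up pages. *)
Record min_flow_inv (y : {ffun page S -> R}) : Prop := MinFlowInv {
  mf_between : flow_between y0 y;
  mf_changed : forall q, y q != y0 q ->
    [/\ q \in U, y0 q < 1 & non_tight y0 (owner q)];
  mf_mass : forall j, (reserve j)%:R <= mass y j;
  mf_lev : levelled y;
  mf_ordered : forall q q', q \in U -> q' \in U -> fresh (owner q) ->
    non_tight y (owner q') -> y q <= y q' \/
    (owner q' = i /\ forall q'', owner q'' <> i -> y q'' = y0 q'')
}.

Lemma min_flow_step y d : min_flow_inv y -> 0 <= d ->
  (forall e, 0 <= e < d ->
     active_min s (raise (active_min s y) e y) = active_min s y) ->
  min_flow_inv (raise (active_min s y) d y).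
Proof.
move=> [bd ch ms lev ord] d0 cst; set A := active_min s y.
have E1 y' q : q \in active_min s y' -> y' q < 1.
  by case/active_minP => /evictableP[].
have bd' : flow_between y0 (raise A d y).
  move=> q; have /andP[b1 b2] := bd q.
  by rewrite (le_trans b1 (raise_ge _ _ _ d0)) /= raise_le1.
(* Before time [d] the active pages stay minimal, so none overtakes an idle page of an agent that is
   still non-tight; the limit gives the bound at [d]. *)
have le_raise q q' : q \in A -> q' \notin A -> q' \in U ->
    non_tight (raise A d y) (owner q') -> y q <= y q' -> y q + d <= y q'.
  move=> qA q'A q'U nt le; have := bd q' => /andP[_].
  rewrite le_eqVlt => /predU1P[->|q'1].
    by have := bd' q; rewrite ffunE qA => /andP[].
  rewrite -[d]mulr1; apply: le_slope_limit => // e ed; rewrite mulr1.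
  have := qA; rewrite /A -(cst e ed) => /active_minP[_ /(_ q')].
  rewrite !ffunE qA (negPf q'A); apply; apply/evictableP; split=> //.
    by rewrite ffunE (negPf q'A).
  apply: non_tight_le nt => q''; rewrite !ffunE; case: ifP => // _.
  by case/andP: ed => _ /ltW; rewrite lerD2l.
split=> //.
- move=> q; rewrite ffunE; case: ifP => [qA _|_ /ch //].
  have /active_minP[/evictableP[qU q1 nt] _] := qA.
  split=> //; first by have /andP[/le_lt_trans-> //] := bd q.
  by apply: non_tight_le nt => q'; case/andP: (bd q').
- move=> j; rewrite mass_raise.
  case: (posnP #|[set q in A | owner q == j]|) => [->|/card_gt0P[q]].
    by rewrite mulr0 subr0.
  rewrite inE => /andP[qA /eqP qj].
  set c := #|_|%:R; suff : (reserve j)%:R + d * c <= mass y j by lra.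
  apply: le_slope_limit => [||e ed]; [by rewrite ler0n | exact: ms |].
  have := qA; rewrite /A -(cst e ed).
  case/active_minP=> /evictableP[_ _]; rewrite qj non_tightE mass_raise -/c.
  by move=> ? _; lra.
- move=> q q' qU q'U e; have e2 := lev _ _ qU q'U e.
  (* Membership in the active set depends only on the owner and the value, so equal pages of one
     agent rise together. *)
  have twin a b : a \in U -> b \in U -> owner a = owner b -> y a = y b ->
      a \in A -> b \in A.
    move=> aU bU ab yab /active_minP[/evictableP[_ a1 nt] amin].
    by apply/active_minP; split=> [|q'' /amin]; [apply/evictableP|]; rewrite -?ab -yab.
  have qq' : (q \in A) = (q' \in A) by apply/idP/idP; apply: twin.
  by rewrite !ffunE e2 qq'.
- move=> q q' qU q'U fq nt.
  have nt_y : non_tight y (owner q').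
    by apply: non_tight_le nt => q''; apply: raise_ge.
  have first_case : y q <= y q' -> raise A d y q <= raise A d y q'.
    move=> le; rewrite !ffunE; case: ifP => [qA|_]; case: ifP => [q'A|/negbT q'A] //.
    - by rewrite lerD2r.
    - exact: le_raise.
    - by rewrite (le_trans le) // lerDl.
  have [/first_case|[q'i un]] := ord q q' qU q'U fq nt_y; first by left.
  (* An active page [q''] of another agent is minimal, so [y q <= y q'' <= y q'] and [i] has caught
     up. Otherwise only [i] gives up pages in this step. *)
  have [[q'' [q''A q''i]]|N] := pselect (exists q'', q'' \in A /\ owner q'' <> i).
    left; apply: first_case.
    have /active_minP[/evictableP[q''U q''1 q''nt] q''min] := q''A.
    have [le|[//]] := ord q q'' qU q''U fq q''nt.
    apply: (le_trans le); have := bd q' => /andP[_].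
    rewrite le_eqVlt => /predU1P[->|q'1]; first exact: ltW.
    by apply: q''min; apply/evictableP.
  right; split=> // q'' q''i; rewrite ffunE; case: ifP => [q''A|_]; last exact: un.
  by case: N; exists q''.
Qed.

Lemma min_flow_inv0 : min_flow_inv y0.
Proof.
split=> //.
- by move=> q; rewrite lexx y0_le1.
- by move=> q; rewrite eqxx.
- move=> q q' qU q'U fq nt.
  have [q'i|/eqP q'i] := eqVneq (owner q') i; first by right.
  by left; apply: y0_ordered.
Qed.

Lemma min_flow z : flow (active_min s) y0 z -> min_flow_inv z.
Proof.
move=> fl; apply: (flow_invariant _ fl) min_flow_inv0.
exact: min_flow_step.
Qed.

Lemma evictable_raise y A d : 0 <= d ->
  evictable s (raise A d y) \subset evictable s y.
Proof.
move=> d0; apply/fintype.subsetP => q /evictableP[qU q1 nt]; apply/evictableP; split=> //.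
  exact: le_lt_trans (raise_ge _ _ _ d0) q1.
by apply: non_tight_le nt => q'; apply: raise_ge.
Qed.

(* The active set changes only when the target is reached, a page has left the
   cache, an agent becomes tight, or the level reaches that of another evictable
   page; [d] is the time of the first of these events. *)
Lemma min_flow_advance y (T : R) : min_flow_inv y -> \sum_q y q < T ->
  evictable s y != finset.set0 ->
  exists d, let y' := raise (active_min s y) d y in
  [/\ 0 <= d,
      forall e, 0 <= e < d ->
        active_min s (raise (active_min s y) e y) = active_min s y,
      \sum_q y' q <= T &
      [\/ \sum_q y' q = T, evictable s y' \proper evictable s y |
       evictable s y' = evictable s y /\
       evictable s y' :\: active_min s y' \proper
       evictable s y :\: active_min s y]].
Proof.
move=> [bd ch ms lev ord] yT /finset.set0Pn[q1 q1ev].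
set A := active_min s y.
have [q0 q0A] : exists q0, q0 \in A.
  case: (@arg_minP _ _ _ q1 (fun q => q \in evictable s y) y q1ev) => q0 q0ev q0min.
  by exists q0; apply/active_minP.
have /active_minP[q0ev q0min] := q0A.
have /evictableP[q0U q01 q0nt] := q0ev.
pose l := y q0.
have Al q : q \in A -> y q = l by move/active_min_level; apply.
have A0 : 0 < #|A|%:R :> R by rewrite ltr0n; apply/card_gt0P; exists q0.
pose c j : R := #|[set q in A | owner q == j]|%:R.
have c0 j : 0 <= c j by rewrite ler0n.
(* Event times: the active pages leave the cache, an agent becomes tight, the level meets a higher
   evictable page. The time of reaching [T] is added below. *)
pose bs := (1 - l) ::
  [seq (mass y j - (reserve j)%:R) / c j | j <- enum 'I_(agents S) & 0 < c j] ++
  [seq y q - l | q <- enum (evictable s y :\: A)].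
have [d dl dmin] := seq_min_ex bs ((T - \sum_q y q) / #|A|%:R).
have sumA e : \sum_q raise A e y q = \sum_q y q + e * #|A|%:R.
  rewrite (sum_raise A e y xpredT); congr (_ + _ * _%:R).
  by apply: eq_card => q; rewrite !inE andbT.
have ntA q : q \in A -> non_tight y (owner q).
  by case/active_minP => /evictableP[].
have cA j : 0 < c j -> non_tight y j.
  rewrite ltr0n => /card_gt0P[q]; rewrite inE => /andP[qA /eqP<-].
  exact: ntA.
have ltl q : q \in evictable s y :\: A -> l < y q.
  rewrite inE => /andP[qA qev]; rewrite lt_neqAle q0min // andbT.
  apply: contraNneq qA => lq; apply/active_minP; split=> // q' q'ev.
  by rewrite -lq q0min.
have dpos : 0 < d.
  move: dl; rewrite inE => /predU1P[->|].
    by rewrite divr_gt0 // subr_gt0.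
  rewrite /bs inE mem_cat => /or3P[/eqP->|/mapP[j]|/mapP[q]].
  - by rewrite subr_gt0.
  - rewrite mem_filter => /andP[cj _] ->; rewrite divr_gt0 // subr_gt0.
    by rewrite -non_tightE cA.
  - by rewrite mem_enum => /ltl; rewrite -subr_gt0 => ? ->.
have d1 : d <= 1 - l by apply: dmin; rewrite !inE eqxx orbT.
have dT : d * #|A|%:R <= T - \sum_q y q.
  by rewrite -ler_pdivlMr // dmin // inE eqxx.
have dj j : d * c j <= mass y j - (reserve j)%:R.
  have [c_le0|cj] := leP (c j) 0.
    have -> : c j = 0 by apply/le_anti; rewrite c_le0 c0.
    by rewrite mulr0 subr_ge0.
  rewrite -ler_pdivlMr // dmin // !inE mem_cat; apply/orP; right.
  by apply/orP; right; apply/orP; left; apply/mapP; exists j => //;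
    rewrite mem_filter mem_enum andbT; exact: cj.
have dq q : q \in evictable s y :\: A -> d <= y q - l.
  move=> H; apply: dmin; rewrite !inE mem_cat; apply/orP; right.
  by apply/orP; right; apply/orP; right; apply/mapP; exists q; rewrite ?mem_enum.
(* Strictly before the first event no page has left and no agent has become tight. *)
have ev_before e : 0 <= e < d -> evictable s (raise A e y) = evictable s y.
  move=> /andP[e0 ed]; apply/eqP; rewrite finset.eqEsubset evictable_raise //=.
  apply/fintype.subsetP => q qev; have /evictableP[qU qlt1 qnt] := qev.
  apply/evictableP; split=> //.
    by rewrite ffunE; case: ifP => // /Al ->; lra.
  rewrite non_tightE mass_raise -/(c _).
  have := c0 (owner q); rewrite le_eqVlt => /predU1P[<-|cq].
    by rewrite mulr0 subr0 -non_tightE.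
  have := dj (owner q); have : e * c (owner q) < d * c (owner q) by rewrite ltr_pM2r.
  lra.
have cst e : 0 <= e < d -> active_min s (raise A e y) = A.
  move=> ed; have /andP[e0 ed'] := ed; apply/setP => q; apply/active_minP/idP.
    rewrite ev_before // => -[qev qmin].
    apply/negPn/negP => qA; have := qmin _ q0ev; rewrite !ffunE q0A (negPf qA).
    have := dq q; rewrite inE qA qev => /(_ isT); rewrite -/l; lra.
  move=> qA; rewrite ev_before //; have /active_minP[qev qmin] := qA; split=> // q' q'ev.
  rewrite !ffunE qA; case: ifP => [_|/negbT q'A]; first by rewrite lerD2r qmin.
  by have := dq q'; rewrite inE q'A q'ev => /(_ isT); rewrite (Al q qA); lra.
exists d => /=; split=> //; first exact: ltW.
  by rewrite sumA; lra.
have sub := evictable_raise y A (ltW dpos).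
have drop q : q \in evictable s y -> q \notin evictable s (raise A d y) ->
    evictable s (raise A d y) \proper evictable s y.
  by move=> qev qN; apply/properP; split=> //; exists q.
move: dl; rewrite inE => /predU1P[dE|].
  by apply: Or31; rewrite sumA dE divfK ?gt_eqF //; lra.
rewrite /bs inE mem_cat => /or3P[/eqP dE|/mapP[j]|/mapP[q]].
- apply: Or32; apply: (drop q0) => //; apply/evictableP => -[_].
  by rewrite ffunE q0A -/l dE; lra.
- rewrite mem_filter => /andP[cj _] dE; apply: Or32.
  move: (cj); rewrite ltr0n => /card_gt0P[q]; rewrite inE => /andP[qA /eqP qj].
  have /active_minP[qev _] := qA; apply: (drop q) => //.
  apply/evictableP => -[_ _]; rewrite non_tightE qj mass_raise -/(c j) dE divfK ?gt_eqF //.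
  by lra.
- rewrite mem_enum => qN dE.
  (* The level has met [y q]. If the evictable set is unchanged, [q] joins the active pages. *)
  have [eq|ne] := eqVneq (evictable s (raise A d y)) (evictable s y); last first.
    by apply: Or32; rewrite finset.properEneq ne.
  apply: Or33; split=> //; apply/properP; move: (qN); rewrite inE => /andP[qA qev].
  have lmin q' : q' \in evictable s y -> l + d <= raise A d y q'.
    move=> q'ev; rewrite ffunE; case: ifP => [/Al->//|/negbT q'A].
    by have := dq q'; rewrite inE q'A q'ev => /(_ isT); lra.
  split; last exists q => //.
    rewrite eq; apply/fintype.subsetP => q'; rewrite !finset.in_setD => /andP[q'N q'ev].
    rewrite q'ev andbT; apply: contra q'N => q'A; apply/active_minP; rewrite eq; split=> // q''.
    by rewrite [raise A d y q']ffunE q'A (Al _ q'A); apply: lmin.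
  rewrite finset.in_setD negb_and negbK; apply/orP; left.
  apply/active_minP; rewrite eq; split=> // q'' /lmin.
  by rewrite [raise A d y q]ffunE (negPf qA) dE; lra.
Qed.

Lemma min_flow_ex (T : R) : \sum_q y0 q <= T ->
  (forall y, min_flow_inv y -> \sum_q y q < T -> evictable s y != finset.set0) ->
  exists z, flow (active_min s) y0 z /\ \sum_q z q = T.
Proof.
move=> le ne.
(* Lexicographic measure: first the evictable pages, then those above the level, which number at
   most [#|page S|]. *)
pose mu y := (#|evictable s y| * #|page S|.+1 + #|evictable s y :\: active_min s y|)%N.
have main n : forall y, (mu y < n)%N -> min_flow_inv y -> \sum_q y q <= T ->
    exists z, flow (active_min s) y z /\ \sum_q z q = T.
  elim: n => // n IH y; rewrite ltnS => lt inv; rewrite le_eqVlt => /predU1P[<-|yT].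
    by exists y; split=> //; apply: flow_stop.
  have [d [d0 cst y'T alt]] := min_flow_advance inv yT (ne _ inv yT).
  set y' := raise _ d y in y'T alt.
  have inv' : min_flow_inv y' by exact: min_flow_step.
  suff [z [fl zT]] : exists z, flow (active_min s) y' z /\ \sum_q z q = T.
    by exists z; split=> //; apply: (@flow_step _ _ _ _ _ d).
  case: alt => [eqT|pr|[eq pr]].
  - by exists y'; split=> //; apply: flow_stop.
  - apply: IH => //; apply: leq_trans lt; rewrite /mu.
    have := proper_card pr.
    have : (#|evictable s y' :\: active_min s y'| <= #|page S|)%N by apply: max_card.
    by nia.
  - apply: IH => //; apply: leq_trans lt; rewrite /mu eq ltn_add2l.
    by have := proper_card pr; rewrite eq.
by apply: (main (mu y0).+1) => //; apply: min_flow_inv0.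
Qed.

End MinFlow.
End Flows.

(** * Invariant, potentials and the end of a phase *)

Section Invariant.
Context {R : realType} {S : setting}.
Implicit Types (y z X : {ffun page S -> R}) (M U : {set page S}).
Implicit Types (p q : page S) (i j : 'I_(agents S)).
Implicit Types (I G : {set 'I_(agents S)}) (s : state R S).
Notation k := (cache_size S).

(* [G] is the set of agents that have left isolation during the current global
   phase.  Everything they hold is marked, and the lower bound charges their
   later misses differently from those of the agents that started the phase
   non-isolated. *)
Record marking_inv s G : Prop := Inv {
  inv_bounds : forall q, 0 <= yval s q <= 1;
  inv_sum : \sum_q yval s q = #|page S|%:R - k%:R;
  inv_marked : forall q, q \in marked s -> yval s q = 0;
  inv_support : forall q, yval s q < 1 -> q \in marked s \/ q \in unmarked s;
  inv_mass : forall j, (reserve j)%:R <= mass (yval s) j;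
  inv_isolated : forall j, j \in isolated s ->
    mass (yval s) j = (reserve j)%:R /\ (#|marked_of s j| < reserve j)%N;
  inv_levelled : levelled s (yval s);
  inv_ordered : forall q q', q \in unmarked s -> q' \in unmarked s ->
    owner q \notin isolated s :|: G -> non_tight (yval s) (owner q') ->
    yval s q <= yval s q';
  inv_released : forall j, j \in G -> [/\ j \notin isolated s,
    (reserve j <= #|marked_of s j|)%N &
    forall q, q \in unmarked s -> owner q = j -> yval s q = 1];
  inv_count : (#|[set q in unmarked s |
    (yval s q < 1)%R && (owner q \notin isolated s)]| <= k)%N;
  inv_count_agent : forall j, (#|[set q in unmarked s |
    (yval s q < 1)%R && (owner q == j)]| <= k)%N
}.

(** One of the cases that do not end the phase applies. [step] does not test again after
    [end_phase], so this has to be proved there. *)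
Definition servable s p := [\/ yval s p = 0, owner p \in isolated s |
  exists q, [/\ q \in unmarked s, yval s q < 1 &
                owner q = owner p \/ non_tight (yval s) (owner q)]].

Lemma sum_by_owner I (f : page S -> R) :
  \sum_(q | owner q \in I) f q = \sum_(j in I) \sum_(q | owner q == j) f q.
Proof.
rewrite (partition_big (@owner S) (mem I)) //=; apply: eq_bigr => j jI.
by apply: eq_bigl => q; case: eqP => [->|]; rewrite ?jI ?andbF.
Qed.

Lemma unmarked_notin_marked s q : q \in unmarked s -> q \notin marked s.
Proof. by rewrite inE => /andP[]. Qed.

Lemma in_sep (T : finType) (A : {set T}) (b : pred T) x :
  (x \in [set x' in A | b x']) = (x \in A) && b x.
Proof. by rewrite inE. Qed.

(** * The potential for the lower bound on the offline cost *)

Section Potential.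
Variables (M U : {set page S}) (I G : {set 'I_(agents S)}).

(** At [x = 1], marking a page never raises the value and lowers it by 1 exactly when the page was
    neither marked nor unmarked, or was an unmarked page of an agent in [G]. These are the full
    misses. All slopes lie between 0 and 4. *)
Definition psi q (x : R) : R :=
  if q \in M then
    if owner q \in I then x + 2 else if owner q \in G then x + 1 else 2
  else if q \in U then
    if (owner q \in I) || (owner q \in G) then 3 * x else 2 * x
  else if owner q \in I then 4 * x else 3 * x.

(* The lower bound on the cost of an offline solution [X] comes from this
   potential: it grows by at most 4 per unit of offline cost, and drops by 1
   whenever the algorithm misses a page that is entirely outside its cache. *)
Definition Psi (X : {ffun page S -> R}) : R :=
  \sum_q psi q (X q) - \sum_(j in I) (reserve j)%:R.

Lemma psi_bounds q x : 0 <= x <= 1 -> 0 <= psi q x <= 4.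
Proof. by rewrite /psi => x01; do ![case: ifP => _]; lra. Qed.

Lemma psi_le q x x' : x' <= x -> psi q x' <= psi q x.
Proof. by rewrite /psi => xx; do ![case: ifP => _]; lra. Qed.

Lemma psi_load q x x' : x <= x' -> psi q x' <= psi q x + 4 * (x' - x).
Proof. by rewrite /psi => xx; do ![case: ifP => _]; lra. Qed.

Lemma Psi_move X X' p : X p <= 1 -> X' p = 1 ->
  (forall q, q != p -> X' q <= X q) -> Psi X' <= Psi X + 4 * (1 - X p).
Proof.
move=> Xp X'p le; rewrite /Psi addrAC lerD2r.
rewrite (bigD1 p) // [in leRHS](bigD1 p) //= X'p addrAC lerD ?psi_load //.
by apply: ler_sum => q qp; rewrite psi_le ?le.
Qed.

Lemma Psi_ge X : (forall q, 0 <= X q <= 1) -> - k%:R <= Psi X.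
Proof.
move=> X01; rewrite /Psi -[leLHS]add0r lerD //.
  by apply: sumr_ge0 => q _; case/andP: (psi_bounds q (X01 q)).
rewrite lerN2 -natr_sum ler_nat.
rewrite (leq_trans _ (ltnW (reserve_lt S))) // big_mkcond leq_sum // => j _.
by case: ifP.
Qed.

Lemma Psi_le X : (forall q, 0 <= X q <= 1) -> Psi X <= 4 * #|page S|%:R.
Proof.
move=> X01; rewrite /Psi lerBlDr -[leLHS]addr0 lerD ?sumr_ge0 //.
rewrite mulr_natr -sumr_const; apply: ler_sum => q _.
by case/andP: (psi_bounds q (X01 q)).
Qed.

End Potential.

Lemma Psi_mark M U I G X p : X p = 1 -> [disjoint I & G] ->
  Psi (p |: M) (U :\ p) I G X
  + ((p \notin M) && ((p \notin U) || (owner p \in G)))%:R <= Psi M U I G X.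
Proof.
move=> Xp dIG; rewrite /Psi addrAC lerD2r (bigD1 p) // [in leRHS](bigD1 p) //=.
rewrite addrAC lerD //.
  rewrite Xp /psi !inE eqxx /=.
  case: (boolP (p \in M)) => pM; case: (boolP (p \in U)) => pU /=;
  case: (boolP (owner p \in I)) => pI; case: (boolP (owner p \in G)) => pG /=;
  try lra; by have := disjointFr dIG pI; rewrite pG.
by apply: ler_sum => q qp; rewrite /psi !inE qp (negPf qp).
Qed.

(** Each of the [reserve j] marked pages loses 1, from [x + 2] to [x + 1], which makes up for the
    term [- reserve j] that disappears. *)
Lemma Psi_release M U I G X j : (forall q, 0 <= X q) -> j \in I ->
  #|[set q in M | owner q == j]| = reserve j ->
  Psi M U (I :\ j) (j |: G) X <= Psi M U I G X.
Proof.
move=> X0 jI card; rewrite /Psi [in leRHS](big_setD1 j) //= opprD addrA lerD2r.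
rewrite -card -sum1_card natr_sum.
suff : \sum_q psi M U (I :\ j) (j |: G) q (X q) +
       \sum_(q in [set q in M | owner q == j]) 1%:R <= \sum_q psi M U I G q (X q) by lra.
rewrite [X in _ + X]big_mkcond -big_split /=; apply: ler_sum => q _.
rewrite /psi !inE; case: eqP => [->|_] /=.
  rewrite jI andbT; have := X0 q.
  by case: (q \in M); case: (q \in U); case: (j \in G) => /=; lra.
by rewrite andbF addr0.
Qed.

Definition Phi s : R := \sum_(q in unmarked s) phi (yval s q).

Lemma Phi_ge0 s G : marking_inv s G -> 0 <= Phi s.
Proof. by move=> H; apply: sumr_ge0 => q _; rewrite phi_ge0 // (inv_bounds H). Qed.

(** * The end of a global phase *)

Section EndPhase.
Variables (s : state R S) (G : {set 'I_(agents S)}) (p : page S).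
Hypotheses (H : marking_inv s G) (over : phase_over s p).
Notation y := (yval s).
Notation I' := (isolated (end_phase s)).

Lemma in_isolated_end j : (j \in I') = (#|marked_of s j| < reserve j)%N.
Proof. by rewrite inE. Qed.

Lemma in_marked_end q :
  (q \in marked (end_phase s)) = (q \in marked s) && (owner q \in I').
Proof. by rewrite inE. Qed.

Lemma in_unmarked_end q : (q \in unmarked (end_phase s)) =
  if owner q \in I' then q \in unmarked s else y q < 1.
Proof.
rewrite [LHS]inE in_marked_end /=.
case: (owner q \in finset _); rewrite /= ?andbT ?andbF /= ?eqxx.
  by rewrite [RHS]inE.
by rewrite inE eqxx andbT.
Qed.

Lemma over_nothing q : q \in unmarked s -> y q < 1 ->
  owner q <> owner p /\ ~~ non_tight y (owner q).
Proof.
move=> qU q1; case/and3P: over => _ _ /forall_inP/(_ q qU).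
by rewrite q1 /= negb_or => /andP[/eqP].
Qed.

(** Fewer marked pages than the reserve cannot make up the mass, so part of an unmarked page must be
    in the cache. *)
Lemma isolated_end_has j : j \in I' ->
  exists q, [/\ q \in unmarked s, y q < 1 & owner q = j].
Proof.
rewrite in_isolated_end => lt.
have [//|N] := pselect (exists q, [/\ q \in unmarked s, y q < 1 & owner q = j]).
have := inv_mass H j; rewrite (mass_zero_on_exact (inv_marked H)).
  by rewrite ler_nat leqNgt lt.
move=> q qM qj; apply/le_anti; have /andP[_ ->] := inv_bounds H q; rewrite leNgt.
apply/negP => q1; apply: N; exists q; split=> //.
by case: (inv_support H q1) => // ; rewrite (negPf qM).
Qed.

Lemma mass_isolated_end j : j \in I' -> mass y j = (reserve j)%:R.
Proof.
case/isolated_end_has => q [qU q1 <-]; have [_] := over_nothing qU q1.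
by rewrite non_tightE -leNgt => le; apply/le_anti; rewrite le (inv_mass H).
Qed.

Lemma isolated_end_sub j : j \in isolated s -> j \in I'.
Proof. by move=> /(inv_isolated H)[_]; rewrite in_isolated_end. Qed.

(** An unmarked page partly in the cache would make its agent tight, yet the marked pages alone
    already fill the reserve. *)
Lemma support_end q : owner q \notin I' -> (y q < 1) = (q \in marked s).
Proof.
rewrite in_isolated_end -leqNgt => le; apply/idP/idP; last first.
  by move/(inv_marked H) ->.
move=> q1; have [//|qU] := inv_support H q1.
have [_] := over_nothing qU q1; rewrite non_tightE -leNgt => tight.
have := mass_zero_on_ge (inv_marked H) (fun q => proj2 (andP (inv_bounds H q)))
  (unmarked_notin_marked qU) erefl.
move: le; rewrite -(ler_nat R) /marked_of; lra.
Qed.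

Lemma val_end q : owner q \notin I' -> y q = (q \notin marked s)%:R.
Proof.
move=> qI; have := support_end qI; case: (boolP (q \in marked s)) => [/(inv_marked H)->//|_].
by have /andP[_] := inv_bounds H q; rewrite le_eqVlt => /predU1P[-> //|->].
Qed.

(** The cache is full; non-isolated agents hold exactly their marked pages, and the newly isolated
    ones are tight. *)
Lemma size_end :
  \sum_(q | owner q \notin I') (q \in marked s)%:R +
  \sum_(j in I') (reserve j)%:R = k%:R :> R.
Proof.
have -> : k%:R = \sum_q (1 - y q) by rewrite sumrB sumr_const (inv_sum H); ring.
rewrite [RHS](bigID (fun q => owner q \in I')) [RHS]addrC /=; congr (_ + _).
  by apply: eq_bigr => q /val_end ->; case: (_ \in _); rewrite ?subrr ?subr0.
by rewrite sum_by_owner; apply: eq_bigr => j /mass_isolated_end <-.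
Qed.

(** Unmarked pages of non-isolated agents restart at 0, and [size_end] bounds their number. Isolated
    agents keep their pages and inherit the old bounds, hence the separate count per agent. *)
Lemma inv_end : marking_inv (end_phase s) finset.set0.
Proof.
have unm_y0 q : q \in unmarked (end_phase s) -> owner q \notin I' -> y q = 0.
  by move=> qU qI; move: qU; rewrite in_unmarked_end (negPf qI) support_end // => /(inv_marked H).
have marked_in j : j \in I' -> marked_of (end_phase s) j = marked_of s j.
  move=> jI; apply/setP => q; rewrite !inE -in_isolated_end.
  by case: eqP => [->|_]; rewrite ?andbF // jI !andbT.
have count0 (B : {set page S}) :
    (forall q, q \in B -> owner q \notin I' /\ q \in marked s) -> (#|B| <= k)%N.
  move=> HB; rewrite -(ler_nat R) -size_end -sum1_card natr_sum.
  rewrite -[leLHS]addr0 lerD ?sumr_ge0 //.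
  rewrite big_mkcond [leRHS]big_mkcond; apply: ler_sum => q _.
  case: ifP => [/HB[-> ->] //|_]; case: ifP => // _; exact: ler0n.
split=> /=.
- exact: inv_bounds H.
- exact: inv_sum H.
- by move=> q; rewrite in_marked_end => /andP[/(inv_marked H)].
- move=> q q1; have [qI|qI] := boolP (owner q \in I'); last first.
    by right; rewrite in_unmarked_end (negPf qI).
  by rewrite in_marked_end in_unmarked_end qI andbT; apply: inv_support H _ q1.
- exact: inv_mass H.
- move=> j jI; have jI' : j \in I' by [].
  by rewrite marked_in // mass_isolated_end // -in_isolated_end.
- move=> q q' qU q'U e; have [qI|qI] := boolP (owner q \in I'); last first.
    by rewrite !unm_y0 // -e.
  move: qU q'U; rewrite !in_unmarked_end -e qI => qU q'U.
  exact: (inv_levelled H).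
- move=> q q' qU q'U; rewrite finset.setU0 => qI _.
  by rewrite (unm_y0 q) //; have /andP[] := inv_bounds H q'.
- by move=> j; rewrite inE.
- apply: count0 => q; rewrite in_sep => /and3P[qU q1 qI]; split=> //.
  by rewrite -support_end.
- move=> j; have [jI|jI] := boolP (j \in I').
    apply: leq_trans (inv_count_agent H j); apply: subset_leq_card.
    apply/fintype.subsetP => q; rewrite !in_sep => /and3P[+ -> /eqP qj].
    by rewrite in_unmarked_end qj jI eqxx => ->.
  apply: count0 => q; rewrite in_sep => /and3P[qU q1 /eqP qj]; rewrite qj.
  by rewrite -support_end // qj.
Qed.

(** The reserves sum to less than [k], so some agent is non-tight. It is not isolated, and whatever
    it holds has just become unmarked. *)
Lemma servable_end : servable (end_phase s) p.
Proof.
have [j jnt] : exists j, non_tight y j.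
  have [//|N] := pselect (exists j, non_tight y j).
  have : k%:R <= \sum_(j < agents S) (reserve j)%:R :> R.
    rewrite (_ : k%:R = \sum_j mass y j); last by rewrite sum_mass (inv_sum H); ring.
    apply: ler_sum => j _; rewrite leNgt; apply/negP => jnt; apply: N.
    by exists j; rewrite non_tightE.
  by rewrite -natr_sum ler_nat leqNgt reserve_lt.
have jI : j \notin I'.
  by apply/negP => /mass_isolated_end e; move: jnt; rewrite non_tightE e ltxx.
apply: Or33.
have [//|N] := pselect (exists q, [/\ q \in unmarked (end_phase s),
  yval (end_phase s) q < 1 &
  owner q = owner p \/ non_tight (yval (end_phase s)) (owner q)]).
exfalso; have := jnt; rewrite non_tightE /mass big1; first by rewrite ltNge ler0n.
move=> q /eqP qj; apply/eqP; rewrite subr_eq0 eq_le.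
have /andP[_ ->] := inv_bounds H q; rewrite andbT leNgt; apply/negP => q1; apply: N.
exists q; split=> //; first by rewrite in_unmarked_end qj (negPf jI).
by right; rewrite qj.
Qed.

Lemma Phi_end : Phi (end_phase s) <= Phi s.
Proof.
rewrite /Phi big_mkcond [leRHS]big_mkcond; apply: ler_sum => q _.
rewrite in_unmarked_end; case: (boolP (owner q \in I')) => qI //=.
case: ifP => [|_]; last by case: ifP => // _; rewrite phi_ge0 // (inv_bounds H).
rewrite support_end // => qM; rewrite (inv_marked H qM) phi0.
by case: ifP.
Qed.

Lemma Psi_end X : feasible X ->
  Psi (marked (end_phase s)) (unmarked (end_phase s)) I' finset.set0 X <=
  Psi (marked s) (unmarked s) (isolated s) G X.
Proof.
case=> X01 Xk Xres.
(* Summed over all pages, the corrections are the offline content of the agents outside [isolated s]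
   minus the marked pages counted in [size_end]. *)
have page_bound q :
    psi (marked (end_phase s)) (unmarked (end_phase s)) I' finset.set0 q (X q)
    <= psi (marked s) (unmarked s) (isolated s) G q (X q)
    + (if owner q \notin isolated s then X q else 0)
    - (if owner q \notin I' then (q \in marked s)%:R else 0).
  have := X01 q; rewrite /psi in_marked_end in_unmarked_end finset.in_set0 orbF.
  case: (boolP (owner q \in I')) => qI /=.
    rewrite andbT; case: (boolP (owner q \in G)) => qG.
      have [_ + _] := inv_released H qG.
      by move: qI; rewrite in_isolated_end ltnNge => /negPf->.
    by case: (q \in marked s); case: (q \in unmarked s);
      case: (owner q \in isolated s) => /=; lra.
  have -> : owner q \in isolated s = false.
    by apply: contraNF qI; exact: isolated_end_sub.
  rewrite andbF support_end //=.
  by case: (q \in marked s); case: (q \in unmarked s);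
    case: (owner q \in G) => /=; lra.
have le := @ler_sum R _ (index_enum (page S)) xpredT _ _ (fun q _ => page_bound q).
rewrite sumrB big_split /= -!big_mkcond /= in le.
have Xiso : \sum_(j in isolated s) (reserve j)%:R +
    \sum_(q | owner q \notin isolated s) X q <= k%:R.
  apply: le_trans Xk; rewrite [leRHS](bigID (fun q => owner q \in isolated s)) /=.
  by rewrite lerD2r sum_by_owner; apply: ler_sum => j _.
by have := size_end; rewrite /Psi; lra.
Qed.

End EndPhase.
End Invariant.

(** * Serving a request *)

Section Serve.
Context {R : realType} {S : setting}.
Implicit Types (y z X : {ffun page S -> R}) (q : page S) (j : 'I_(agents S)).
Notation k := (cache_size S).
Variables (s : state R S) (G : {set 'I_(agents S)}) (p : page S).
Hypothesis H : marking_inv s G.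
Notation y := (yval s).
Notation i := (owner p).
Notation U := (unmarked s).
Notation U' := (unmarked (mark s p)).
Notation M := (marked s).
Notation M' := (p |: marked s).

Lemma disjoint_released : [disjoint isolated s & G].
Proof.
rewrite disjoint_subset; apply/fintype.subsetP => j jI.
by apply/negP => jG; have [] := inv_released H jG; rewrite jI.
Qed.

Lemma in_unmarked_mark q : (q \in U') = (q != p) && (q \in U).
Proof. by rewrite !inE /= negb_or; case: (q == p); rewrite ?andbF. Qed.

Lemma unmarked_set_y (s' : state R S) z : unmarked (set_y s' z) = unmarked s'.
Proof. by []. Qed.

Definition released : {set 'I_(agents S)} :=
  if (i \in isolated s) && (#|marked_of (mark s p) i| == reserve i)
  then i |: G else G.

Lemma isolated_serve z : isolated (set_y (mark s p) z) =
  if (i \in isolated s) && (#|marked_of (mark s p) i| == reserve i)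
  then isolated s :\ i else isolated s.
Proof.
rewrite /= -/(marked_of _ _); case: (boolP (i \in _)) => //= iI.
case: ifP => // _; apply/setP => j; rewrite !inE.
by case: eqP => // ->; rewrite (negPf iI).
Qed.

(** The agents exempt from the ordering stay the same while a request is served. *)
Lemma isolatedU_released z :
  isolated (set_y (mark s p) z) :|: released = isolated s :|: G.
Proof.
rewrite isolated_serve /released; case: ifP => // /andP[iI _].
by apply/setP => j; rewrite !inE; case: eqP => [->|] //=; rewrite iI.
Qed.

Lemma card_marked_mark j : (#|marked_of s j| <= #|marked_of (mark s p) j| <=
  #|marked_of s j| + (j == i))%N.
Proof.
apply/andP; split.
  by apply: subset_leq_card; apply/fintype.subsetP => q; rewrite !inE => /andP[-> ->]; rewrite orbT.
case: eqP => [->|ji].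
  rewrite addn1; apply: leq_trans (_ : #|p |: marked_of s i| <= _)%N; last first.
    by rewrite cardsU1; case: (_ \notin _).
  apply: subset_leq_card; apply/fintype.subsetP => q; rewrite !inE.
  by case: eqP.
rewrite addn0; apply: subset_leq_card; apply/fintype.subsetP => q; rewrite !inE.
by case: (q =P p) => //= -> /eqP /esym.
Qed.

Section Result.
(** The hypotheses on [z] cover a hit and both kinds of rebalancing, so that these are analysed
    together. *)
Variable z : {ffun page S -> R}.
Hypothesis z_p : z p = 0.
Hypothesis z_bounds : forall q, q != p -> y q <= z q <= 1.
Hypothesis z_changed : forall q, q != p -> z q != y q -> q \in U.
Hypothesis z_sum : \sum_q z q = #|page S|%:R - k%:R.
Hypothesis z_mass : forall j, (reserve j)%:R <= mass z j.
Hypothesis z_isolated : forall j, j \in isolated s -> mass z j = mass y j.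
Hypothesis z_levelled : levelled (mark s p) z.
Hypothesis z_ordered : forall q q', q \in U' -> q' \in U' ->
  owner q \notin isolated s :|: G -> non_tight z (owner q') -> z q <= z q'.
Notation s' := (set_y (mark s p) z).

Lemma serve_bounds q : 0 <= z q <= 1.
Proof.
have [->|qp] := eqVneq q p; first by rewrite z_p lexx ler01.
have /andP[yz ->] := z_bounds qp; have /andP[y0 _] := inv_bounds H q.
by rewrite andbT (le_trans y0).
Qed.

Lemma serve_marked q : q \in M' -> z q = 0.
Proof.
rewrite in_setU1 => /orP[/eqP->//|qM]; have [->//|qp] := eqVneq q p.
rewrite -(inv_marked H qM); apply/eqP; apply: contraLR qM => /(z_changed qp).
exact: unmarked_notin_marked.
Qed.

Lemma serve_support q : z q < 1 -> q \in M' \/ q \in U'.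
Proof.
move=> q1; rewrite in_setU1 in_unmarked_mark; have [->|qp] := eqVneq q p; first by left.
have : y q < 1 by apply: le_lt_trans q1; case/andP: (z_bounds qp).
by move/(inv_support H) => /= [->|->]; [left|right].
Qed.

(** The mass of an isolated agent equals its reserve, now filled by marked pages, so nothing is left
    for [q]. *)
Lemma serve_released q : i \in isolated s ->
  #|marked_of (mark s p) i| = reserve i -> q \in U' -> owner q = i -> z q = 1.
Proof.
move=> iI card qU qi; apply/le_anti; have /andP[_ ->] := serve_bounds q.
have qM' : q \notin M'.
  by move: qU; rewrite in_unmarked_mark in_setU1 negb_or => /andP[-> /unmarked_notin_marked].
have := mass_zero_on_ge serve_marked (fun q => proj2 (andP (serve_bounds q))) qM' qi.
rewrite (z_isolated iI) (proj1 (inv_isolated H iI)) -card /marked_of /=; lra.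
Qed.

Lemma inv_serve : marking_inv s' released.
Proof.
split.
- exact: serve_bounds.
- exact: z_sum.
- exact: serve_marked.
- exact: serve_support.
- exact: z_mass.
- move=> j; rewrite isolated_serve => jI1.
  have jI : j \in isolated s by move: jI1; case: ifP => // _; rewrite in_setD1 => /andP[].
  have [mj lt] := inv_isolated H jI.
  split; first by rewrite [mass _ _]z_isolated.
  change (#|marked_of (mark s p) j| < reserve j)%N.
  have /andP[_ le] := card_marked_mark j.
  have le' : (#|marked_of (mark s p) j| <= reserve j)%N.
    by apply: leq_trans le _; case: (j == i); rewrite ?addn1 ?addn0 // ltnW.
  (* Reaching the reserve means that [j] owns [p] and has just left isolation. *)
  move: le'; rewrite leq_eqVlt => /predU1P[e|//].
  have ji : j = i by apply/eqP; apply: contraT => /negPf ji; move: le lt; rewrite ji e; lia.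
  by move: jI1; rewrite -ji jI e eqxx /= !inE eqxx.
- exact: z_levelled.
- move=> q q' qU q'U; rewrite isolatedU_released.
  exact: z_ordered.
- move=> j; rewrite /released isolated_serve.
  have old : j \in G -> [/\ j \notin isolated s,
        (reserve j <= #|marked_of (mark s p) j|)%N
      & forall q, q \in U' -> owner q = j -> z q = 1].
    move=> jG; have [jI le all1] := inv_released H jG; split=> //.
      by apply: (leq_trans le); case/andP: (card_marked_mark j).
    move=> q; rewrite in_unmarked_mark => /andP[qp qU] qj; apply/le_anti.
    by have := z_bounds qp; rewrite (all1 q qU qj) => /andP[-> ->].
  case: ifP => [/andP[iI /eqP card]|_ /old //].
  rewrite in_setU1 => /predU1P[->|/old[jI le all1]].
    split; first by rewrite !inE eqxx.
      by rewrite -card; apply: leqnn.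
    by move=> q qU; apply: serve_released.
  by split=> //; rewrite in_setD1 negb_and jI orbT.
- apply: leq_trans (inv_count H); apply: subset_leq_card.
  apply/fintype.subsetP => q; rewrite !in_sep => /and3P[qU' q1 qI].
  have := qU'; rewrite [unmarked _]unmarked_set_y in_unmarked_mark => /andP[qp qU].
  rewrite qU (le_lt_trans _ q1) /=; last by case/andP: (z_bounds qp).
  move: qI; rewrite isolated_serve; case: ifP => // /andP[iI /eqP card].
  rewrite in_setD1 negb_and negbK => /orP[/eqP qi|//].
  by move: q1; rewrite [yval _ _](serve_released iI card qU' qi) ltxx.
- move=> j; apply: leq_trans (inv_count_agent H j); apply: subset_leq_card.
  apply/fintype.subsetP => q; rewrite !in_sep => /and3P[qU' q1 ->].
  have := qU'; rewrite [unmarked _]unmarked_set_y in_unmarked_mark => /andP[qp ->].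
  by rewrite (le_lt_trans _ q1) //; case/andP: (z_bounds qp).
Qed.

Lemma Psi_serve X : (forall q, 0 <= X q) -> X p = 1 ->
  Psi (marked s') (unmarked s') (isolated s') released X +
  ((p \notin M) && ((p \notin U) || (i \in G)))%:R <= Psi M U (isolated s) G X.
Proof.
move=> X0 Xp; apply: le_trans (Psi_mark M U Xp disjoint_released).
rewrite lerD2r.
have -> : unmarked s' = U :\ p.
  by apply/setP => q; rewrite unmarked_set_y in_unmarked_mark in_setD1.
rewrite isolated_serve /released; case: ifP => // /andP[iI /eqP card].
exact: Psi_release.
Qed.

Lemma serve_raised : \sum_(q | q != p) (z q - y q) = y p.
Proof.
have : \sum_q (z q - y q) = 0 by rewrite sumrB z_sum (inv_sum H) subrr.
by rewrite (bigD1 p) //= z_p; lra.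
Qed.

Lemma serve_raised_unmarked : \sum_(q in U') (z q - y q) <= y p.
Proof.
rewrite -serve_raised big_mkcond [leRHS]big_mkcond; apply: ler_sum => q _.
rewrite in_unmarked_mark; case: (boolP (q == p)) => //= qp.
by case: ifP => // _; rewrite subr_ge0; case/andP: (z_bounds qp).
Qed.

Lemma Phi_le_rest : \sum_(q in U') phi (y q) <= Phi s.
Proof.
rewrite /Phi big_mkcond [leRHS]big_mkcond; apply: ler_sum => q _.
rewrite in_unmarked_mark; case: (q == p) => //=; case: ifP => // _.
by rewrite phi_ge0 // (inv_bounds H).
Qed.

(** Marking [p] removes [y p - y p * ln (y p)]. A total of at most [y p] is raised at slope at most
    [- ln (y p)], so a drop of [y p] remains. *)
Lemma Phi_serve_stale : p \in U -> 0 < y p ->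
  (forall q, q != p -> z q != y q -> y p <= y q) -> Phi s' + y p <= Phi s.
Proof.
move=> pU yp0 raised.
have -> : Phi s = phi (y p) + \sum_(q in U') phi (y q).
  by rewrite /Phi (bigD1 p) //=; congr (_ + _); apply: eq_bigl => q;
    rewrite in_unmarked_mark andbC.
have lnyp : 0 <= - ln (y p).
  by rewrite oppr_ge0 ln_le0 //; case/andP: (inv_bounds H p).
have : Phi s' <= \sum_(q in U') (phi (y q) + (z q - y q) * - ln (y p)).
  apply: ler_sum => q; rewrite unmarked_set_y in_unmarked_mark /= => /andP[qp qU].
  have [->|ne] := eqVneq (z q) (y q); first by rewrite subrr mul0r addr0.
  have le := raised q qp ne; have /andP[yz _] := z_bounds qp.
  have := phi_increment (lt_le_trans yp0 le) yz.
  have : (z q - y q) * - ln (y q) <= (z q - y q) * - ln (y p).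
    by rewrite ler_wpM2l ?subr_ge0 // lerN2 ler_ln ?posrE // (lt_le_trans yp0).
  lra.
rewrite big_split /= -mulr_suml.
have := ler_wpM2r lnyp serve_raised_unmarked; rewrite /phi; lra.
Qed.

(** One unit raised at slope [ln k], plus [1 / k] for each of at most [k] pages. *)
Lemma Phi_serve_miss (B : {set page S}) : y p = 1 -> (#|B| <= k)%N ->
  (forall q, q != p -> z q != y q -> q \in B) -> Phi s' <= Phi s + (1 + ln k%:R).
Proof.
move=> yp1 Bk raised.
have k0 : (0 < k)%N by apply: leq_ltn_trans (reserve_lt S).
have kR : 0 < k%:R :> R by rewrite ltr0n.
have lnk : 0 <= ln k%:R :> R by rewrite ln_ge0 // ler1n.
have : Phi s' <= \sum_(q in U') (phi (y q) + (z q - y q) * ln k%:R +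
                                 (if q \in B then k%:R^-1 else 0)).
  apply: ler_sum => q; rewrite unmarked_set_y in_unmarked_mark /= => /andP[qp qU].
  have /andP[yz _] := z_bounds qp; have /andP[y0 _] := inv_bounds H q.
  case: ifP => [_|/negbT qB].
    by have := phi_increment_unif k0 y0 yz; lra.
  have -> : z q = y q by apply/eqP; apply: contraNT qB; apply: raised.
  by rewrite subrr mul0r !addr0.
rewrite !big_split /= -mulr_suml.
have : \sum_(q in U') (if q \in B then k%:R^-1 else 0) <= 1 :> R.
  have le1 : #|B|%:R / k%:R <= 1 :> R by rewrite ler_pdivrMr // mul1r ler_nat.
  apply: le_trans le1; rewrite mulr_natl -sumr_const big_mkcond [leRHS]big_mkcond.
  by apply: ler_sum => q _; case: (q \in U') => //; case: ifP.
have := ler_wpM2r lnk serve_raised_unmarked; rewrite yp1 mul1r.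
have := Phi_le_rest; lra.
Qed.

End Result.

Notation y0 := (load y p).

Lemma load_bounds q : 0 <= y0 q <= 1.
Proof. by rewrite ffunE; case: eqP => _; rewrite ?lexx ?ler01 // (inv_bounds H). Qed.

Lemma load_le q : y0 q <= y q.
Proof.
by rewrite ffunE; case: eqP => [->|//]; case/andP: (inv_bounds H p).
Qed.

Lemma sum_load (B : pred (page S)) :
  \sum_(q | B q) y0 q = \sum_(q | B q) y q - (if B p then y p else 0).
Proof.
rewrite big_mkcond [X in _ = X - _]big_mkcond /= (bigD1 p) //= [X in X - _](bigD1 p) //=.
rewrite ffunE eqxx (eq_bigr (fun q => if B q then y q else 0)); last first.
  by move=> q qp; rewrite ffunE (negPf qp).
by case: (B p); ring.
Qed.

Lemma mass_load j : mass y0 j = mass y j + (if i == j then y p else 0).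
Proof. by rewrite /mass !sumrB sum_load; ring. Qed.

Lemma mass_load_ge j : (reserve j)%:R <= mass y0 j.
Proof.
rewrite mass_load (le_trans (inv_mass H j)) // lerDl; case: ifP => // _.
by case/andP: (inv_bounds H p).
Qed.

Lemma load_levelled : levelled (mark s p) y0.
Proof.
move=> q q'; rewrite !in_unmarked_mark => /andP[qp qU] /andP[q'p q'U] e.
by rewrite !ffunE (negPf qp) (negPf q'p); apply: (inv_levelled H).
Qed.

Lemma load_marked q : q \in M' -> y0 q = 0.
Proof.
by rewrite in_setU1 ffunE; case: eqP => //= _; apply: inv_marked H q.
Qed.

Lemma load_support q : q \notin M' -> y0 q < 1 -> q \in U'.
Proof.
rewrite in_setU1 negb_or ffunE in_unmarked_mark => /andP[qp qM]; rewrite (negPf qp) /=.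
by case/(inv_support H) => //; rewrite (negPf qM).
Qed.

Lemma mass_rest z j : (\sum_q z q = #|page S|%:R - k%:R) ->
  (forall j', j' != j -> mass z j' = mass y j') -> mass z j = mass y j.
Proof.
move=> zs eq; have : \sum_j mass z j = \sum_j mass y j.
  by rewrite !sum_mass zs (inv_sum H).
rewrite (bigD1 j) //= [RHS](bigD1 j) //= (eq_bigr _ eq) => /addIr.
exact.
Qed.

Lemma sum_load_total : \sum_q y0 q = #|page S|%:R - k%:R - y p.
Proof. by rewrite (sum_load xpredT) (inv_sum H). Qed.

(** [rebalance] is a choice with default [y1], so it means something only once a flow to the target
    is known to exist. *)
Lemma rebalanceP E (y1 : {ffun page S -> R}) :
  (exists z, flow E y1 z /\ \sum_q z q = #|page S|%:R - k%:R) ->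
  flow E y1 (rebalance E y1) /\
  \sum_q rebalance E y1 q = #|page S|%:R - k%:R.
Proof. exact: xgetPex. Qed.

(** After loading, the mass of the owner is its reserve plus [y p], while at most [reserve i] pages
    are marked; its unmarked pages can therefore give up [y p]. *)
Lemma rebalance_own : i \in isolated s ->
  let z := rebalance (active_own (mark s p) i) y0 in
  [/\ flow_between y0 z, levelled (mark s p) z,
      forall q, z q != y0 q -> [/\ q \in U', owner q = i & y0 q < 1] &
      \sum_q z q = #|page S|%:R - k%:R].
Proof.
move=> iI z.
have le1 q : y0 q <= 1 by case/andP: (load_bounds q).
suff /rebalanceP[fl zs] : exists z, flow (active_own (mark s p) i) y0 z /\
    \sum_q z q = #|page S|%:R - k%:R.
  by have [] := own_flow fl le1 load_levelled.
apply: own_flow_ex; [exact: load_levelled | exact: le1 |].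
rewrite sum_load_total gerBl.
have /andP[-> _] /= := inv_bounds H p; rewrite -lerBlDl.
have -> : #|page S|%:R - k%:R - (#|page S|%:R - k%:R - y p) = y p by ring.
have [mi lt] := inv_isolated H iI.
have := mass_zero_on i load_marked; rewrite mass_load eqxx mi.
have -> : [set q in M' | owner q == i] = marked_of (mark s p) i by [].
have : #|marked_of (mark s p) i|%:R <= (reserve i)%:R :> R.
  have := card_marked_mark i; rewrite eqxx addn1 ler_nat => /andP[_ le].
  exact: leq_trans le lt.
suff : \sum_(q | (q \notin M') && (owner q == i)) (1 - y0 q) <=
       \sum_(q in U' | owner q == i) (1 - y0 q) by lra.
rewrite big_mkcond [leRHS]big_mkcond; apply: ler_sum => q _.
case: (boolP (q \in M')) => /= qM.
  by case: ifP => // _; rewrite subr_ge0.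
case: (owner q == i); rewrite ?andbF ?andbT //.
case: ifP => // /negbT qU; rewrite subr_le0 leNgt; apply: contra qU.
exact: load_support.
Qed.

(* If nothing is evictable, all masses are integers (the number of marked pages
   or the reserve), so at least one whole unit is still to be evicted.  Then no
   page has been raised yet, against [servable]. *)
Lemma min_flow_progress y1 : servable s p -> y p != 0 -> i \notin isolated s ->
  min_flow_inv (mark s p) y0 i (fun j => j \notin isolated s :|: G) y1 ->
  \sum_q y1 q < #|page S|%:R - k%:R -> evictable (mark s p) y1 != finset.set0.
Proof.
move=> serv yp0 iI [bd ch ms _ _] lt; apply/negP => /eqP ev0.
have noev q : q \in U' -> y1 q < 1 -> ~~ non_tight y1 (owner q).
  move=> qU q1; apply/negP => nt; have : q \in evictable (mark s p) y1 by apply/evictableP.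
  by rewrite ev0 inE.
pose f j := if non_tight y1 j then #|[set q in M' | owner q == j]| else reserve j.
have mass_f j : mass y1 j = (f j)%:R.
  rewrite /f; case: ifP => nt; last first.
    by apply/le_anti; rewrite ms andbT leNgt -non_tightE nt.
  apply: mass_zero_on_exact => q qM.
    rewrite -(load_marked qM); apply/eqP; apply: contraLR qM => /ch[+ _ _].
    by rewrite in_unmarked_mark in_setU1 negb_or => /andP[-> /unmarked_notin_marked].
  move=> qj; apply/le_anti; have /andP[b1 b2] := bd q; rewrite b2 leNgt /=.
  apply/negP => q1; have := noev q; rewrite qj nt.
  by move=> /(_ (load_support qM (le_lt_trans b1 q1)) q1).
have sum_f : (\sum_j f j)%:R = #|page S|%:R - \sum_q y1 q :> R.
  by rewrite natr_sum -sum_mass; apply: eq_bigr => j _; rewrite mass_f.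
(* An integer exceeding [k]. Loading adds only [y p <= 1] to a total of [k], so [y p = 1] and
   nothing has been raised. *)
have kf : k%:R + 1 <= (\sum_j f j)%:R :> R.
  by rewrite natr1 ler_nat -(ltr_nat R) sum_f; lra.
have /andP[_ yp_le1] := inv_bounds H p.
have le_sum : \sum_q y0 q <= \sum_q y1 q.
  by apply: ler_sum => q _; case/andP: (bd q).
have yp1 : y p = 1 by have := sum_load_total; lra.
have y1E q : y1 q = y0 q.
  apply/eqP; rewrite -subr_eq0; move: q.
  have : \sum_q (y1 q - y0 q) == 0.
    by rewrite sumrB subr_eq0 eq_le le_sum andbT; have := sum_load_total; lra.
  rewrite psumr_eq0 => [/allP all0 q|q _]; last by rewrite subr_ge0; case/andP: (bd q).
  by have := all0 q; rewrite mem_index_enum => /(_ isT).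
case: serv => [/eqP|iI'|[q [qU q1 own]]].
- by rewrite (negPf yp0).
- by rewrite iI' in iI.
have qp : q != p by apply: contraTneq q1 => ->; rewrite yp1 ltxx.
have : ~~ non_tight y1 (owner q).
  apply: noev; first by rewrite in_unmarked_mark qp qU.
  by rewrite y1E ffunE (negPf qp).
apply/negP; rewrite negbK; case: own => [->|nt].
  rewrite non_tightE (eq_mass (z := y0)) // mass_load eqxx yp1.
  by have := inv_mass H i; lra.
by apply: non_tight_le nt => q'; rewrite y1E load_le.
Qed.

Lemma rebalance_min : servable s p -> y p != 0 -> i \notin isolated s ->
  let z := rebalance (active_min (mark s p)) y0 in
  min_flow_inv (mark s p) y0 i (fun j => j \notin isolated s :|: G) z /\
  \sum_q z q = #|page S|%:R - k%:R.
Proof.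
move=> serv yp0 iI z.
have le1 q : y0 q <= 1 by case/andP: (load_bounds q).
have ord0 q q' : q \in U' -> q' \in U' -> owner q \notin isolated s :|: G ->
    owner q' <> i -> non_tight y0 (owner q') -> y0 q <= y0 q'.
  rewrite !in_unmarked_mark => /andP[qp qU] /andP[q'p q'U] fq /eqP q'i.
  rewrite non_tightE mass_load eq_sym (negPf q'i) addr0 !ffunE (negPf qp) (negPf q'p).
  exact: (inv_ordered H).
suff /rebalanceP[fl zs] : exists z, flow (active_min (mark s p)) y0 z /\
    \sum_q z q = #|page S|%:R - k%:R.
  by split=> //; apply: (min_flow le1 mass_load_ge load_levelled ord0 fl).
apply: (min_flow_ex le1 mass_load_ge load_levelled ord0).
  by rewrite sum_load_total gerBl; case/andP: (inv_bounds H p).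
by move=> y1; apply: min_flow_progress.
Qed.

End Serve.

(** * Competitive ratio *)

Section Step.
Context {R : realType} {S : setting}.
Implicit Types (y z X : {ffun page S -> R}) (p q : page S) (j : 'I_(agents S)).
Implicit Types (s : state R S) (G : {set 'I_(agents S)}).
Notation k := (cache_size S).

(** A full miss costs 1 and raises [Phi] by at most [1 + ln k]. *)
Definition ratio : R := 2 + ln k%:R.

Lemma cache_size_gt0 : (0 < k)%N.
Proof. exact: leq_ltn_trans (reserve_lt S). Qed.

Lemma ratio_ge1 : 1 <= ratio.
Proof.
have : 0 <= ln k%:R :> R by rewrite ln_ge0 // ler1n cache_size_gt0.
by rewrite /ratio; lra.
Qed.

Definition Theta s G X : R :=
  Phi s + ratio * Psi (marked s) (unmarked s) (isolated s) G X.

(** The last clause is the amortised bound, against an offline cache that has already loaded [p]. *)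
Definition served s G p s' G' : Prop :=
  [/\ marking_inv s' G', yval s' p = 0, forall q, q != p -> yval s q <= yval s' q &
      forall X, (forall q, 0 <= X q) -> X p = 1 ->
      yval s p + Theta s' G' X <= Theta s G X].

(** If [y p = 0], nothing moves. If [y p = 1], it is a full miss, paid by the drop of [Psi] scaled
    by [ratio]. In between, the drop of [Phi] pays. *)
Lemma serve_set_y s G p z : marking_inv s G -> z p = 0 ->
  (forall q, q != p -> yval s q <= z q <= 1) ->
  (forall q, q != p -> z q != yval s q -> q \in unmarked s) ->
  \sum_q z q = #|page S|%:R - k%:R ->
  (forall j, (reserve j)%:R <= mass z j) ->
  (forall j, j \in isolated s -> mass z j = mass (yval s) j) ->
  levelled (mark s p) z ->
  (forall q q', q \in unmarked (mark s p) -> q' \in unmarked (mark s p) ->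
    owner q \notin isolated s :|: G -> non_tight z (owner q') -> z q <= z q') ->
  (yval s p < 1 -> forall q, q != p -> z q != yval s q -> yval s p <= yval s q) ->
  (yval s p = 1 -> p \in unmarked s -> owner p \in G) ->
  (exists2 B : {set page S}, (#|B| <= k)%N &
    forall q, q != p -> z q != yval s q -> q \in B) ->
  served s G p (set_y (mark s p) z) (released s G p).
Proof.
move=> H zp zb zc zs zm zi zl zo stale miss [B Bk Bc]; split=> //.
- exact: inv_serve.
- by move=> q /zb/andP[].
move=> X X0 Xp; have K1 := ratio_ge1.
have := Psi_serve H z X0 Xp; rewrite /Theta.
set P' := Psi _ _ _ _ X; set P := Psi _ _ _ _ X.
set s' := set_y _ z; set b := (_ && _); move=> leP.
have KP : ratio * P' + ratio * b%:R <= ratio * P.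
  by rewrite -mulrDr ler_wpM2l //; lra.
have Kb : 0 <= ratio * b%:R by rewrite mulr_ge0 ?ler0n //; lra.
have /andP[] := inv_bounds H p.
rewrite le_eqVlt => /predU1P[yp0|yp_gt0].
  move=> _; suff : Phi s' <= Phi s by rewrite -yp0; lra.
  have zE q : q != p -> z q = yval s q.
    move=> qp; apply/eqP; rewrite -subr_eq0; move: q qp.
    have := serve_raised H zp zs; rewrite -yp0 => /eqP.
    rewrite psumr_eq0 => [/allP all0 q qp|q qp].
      by have := all0 q; rewrite mem_index_enum qp => /(_ isT).
    by rewrite subr_ge0; case/andP: (zb q qp).
  apply: le_trans (Phi_le_rest p H); rewrite le_eqVlt; apply/orP; left; apply/eqP.
  apply: eq_bigr => q; rewrite unmarked_set_y in_unmarked_mark => /andP[qp _].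
  by rewrite /= zE.
have pM : p \notin marked s.
  by apply/negP => /(inv_marked H) e; rewrite e ltxx in yp_gt0.
rewrite le_eqVlt => /predU1P[yp1|yp_lt1].
  have b1 : b.
    rewrite /b pM; case: (boolP (p \in unmarked s)) => //= pU.
    exact: miss.
  have := Phi_serve_miss H zp zb zs yp1 Bk Bc; rewrite -/s'.
  by move: KP; rewrite b1 mulr1 yp1 /ratio; lra.
have pU : p \in unmarked s by have [|//] := inv_support H yp_lt1; rewrite (negPf pM).
have := Phi_serve_stale H zp zb zs pU yp_gt0 (stale yp_lt1); rewrite -/s'; lra.
Qed.

Lemma serve_correct s G p : marking_inv s G -> servable s p ->
  exists G', served s G p (serve s p) G'.
Proof.
move=> H serv; exists (released s G p); rewrite /serve.
have y1 q : yval s q <= 1 by case/andP: (inv_bounds H q).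
case: eqP => [yp0|/eqP yp0].
  (* A hit is a service that leaves the vector unchanged. *)
  rewrite (_ : mark s p = set_y (mark s p) (yval s)) //.
  apply: serve_set_y => //.
  - by move=> q _; rewrite lexx y1.
  - by move=> q _; rewrite eqxx.
  - exact: inv_sum H.
  - exact: inv_mass H.
  - move=> q q'; rewrite !in_unmarked_mark => /andP[_ qU] /andP[_ q'U].
    exact: (inv_levelled H).
  - move=> q q'; rewrite !in_unmarked_mark => /andP[_ qU] /andP[_ q'U].
    exact: (inv_ordered H).
  - by move=> _ q _; rewrite eqxx.
  - by move=> yp1; move: yp0; rewrite yp1 => /eqP; rewrite oner_eq0.
  - by exists finset.set0 => [|q _]; rewrite ?cards0 ?eqxx.
have ypM : p \notin marked s by apply: contra yp0 => /(inv_marked H) ->.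
have stale_unm : yval s p < 1 -> p \in unmarked s.
  by case/(inv_support H) => //; rewrite (negPf ypM).
have loadE q : q != p -> load (yval s) p q = yval s q.
  by move=> qp; rewrite ffunE (negPf qp).
have loadp : load (yval s) p p = 0 by rewrite ffunE eqxx.
have p_unm' : p \notin unmarked (mark s p) by rewrite in_unmarked_mark eqxx.
case: ifP => [iI|/negbT iI].
  have := rebalance_own H iI; set z := rebalance _ _ => -[bd lev ch zs].
  have zp : z p = 0.
    by rewrite -loadp; apply/eqP; apply: contraNT p_unm' => /ch[].
  have ch' q : q != p -> z q != yval s q ->
      [/\ q \in unmarked s, owner q = owner p & yval s q < 1].
    move=> qp; rewrite -(loadE q qp) => /ch[]; rewrite in_unmarked_mark.
    by rewrite loadE // => /andP[].
  have bd' q : q != p -> yval s q <= z q <= 1 by move=> qp; rewrite -loadE.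
  have mass_other j : j != owner p -> mass z j = mass (yval s) j.
    move=> ji; apply: eq_mass => q qj; apply/eqP; apply: contraNT ji => ne.
    rewrite -qj; have [->//|qp] := eqVneq q p.
    by have [_ -> _] := ch' q qp ne.
  have massE j : mass z j = mass (yval s) j.
    have [->|/mass_other//] := eqVneq j (owner p).
    exact: (mass_rest H zs).
  apply: serve_set_y => //.
  - by move=> q qp /(ch' q qp)[].
  - by move=> j; rewrite massE (inv_mass H).
  - move=> q q' qU q'U fq; rewrite non_tightE massE -non_tightE => nt.
    have qi : owner q != owner p by apply: contraNneq fq => ->; rewrite finset.in_setU iI.
    move: qU q'U; rewrite !in_unmarked_mark => /andP[qp qU] /andP[q'p q'U].
    have -> : z q = yval s q.
      by apply/eqP; apply: contraNT qi => /(ch' q qp)[_ -> _].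
    have /andP[le _] := bd' q' q'p.
    by apply: le_trans le; apply: (inv_ordered H).
  - move=> yp1 q qp /(ch' q qp)[qU qi _].
    by rewrite (inv_levelled H (stale_unm yp1) qU).
  (* With its level at 1 the isolated agent would hold only marked pages, fewer than its reserve. *)
  - move=> yp1 pU; have [mi lt] := inv_isolated H iI; exfalso.
    move: lt; rewrite -(ltr_nat R) -mi (mass_zero_on_exact (inv_marked H)) ?ltxx //.
    move=> q qM qi; apply/le_anti; rewrite y1 leNgt; apply/negP => q1.
    have [|qU] := inv_support H q1; first by rewrite (negPf qM).
    by move: q1; rewrite (inv_levelled H qU pU) // yp1 ltxx.
  - exists [set q in unmarked s | (yval s q < 1) && (owner q == owner p)].
      exact: (inv_count_agent H).
    by move=> q qp /(ch' q qp)[qU qi q1]; rewrite in_sep qU q1 qi eqxx.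
have := rebalance_min H serv yp0 iI; set z := rebalance _ _ => -[[bd ch zm lev ord] zs].
have zp : z p = 0.
  by rewrite -loadp; apply/eqP; apply: contraNT p_unm' => /ch[].
have nt_load j : j != owner p -> non_tight (load (yval s) p) j = non_tight (yval s) j.
  by move=> ji; rewrite !non_tightE mass_load eq_sym (negPf ji) addr0.
have ch' q : q != p -> z q != yval s q -> [/\ q \in unmarked s, yval s q < 1 &
    owner q = owner p \/ non_tight (yval s) (owner q)].
  move=> qp; rewrite -(loadE q qp) => /ch[]; rewrite in_unmarked_mark loadE //.
  move=> /andP[_ qU] q1 nt; split=> //.
  by have [|qi] := eqVneq (owner q) (owner p); [left | right; rewrite -nt_load].
have bd' q : q != p -> yval s q <= z q <= 1 by move=> qp; rewrite -loadE.
have noniso j : non_tight (yval s) j -> j \notin isolated s.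
  by apply: contraL => /(inv_isolated H)[e _]; rewrite non_tightE e ltxx.
apply: serve_set_y => //.
- by move=> q qp /(ch' q qp)[].
- move=> j jI; apply: eq_mass => q qj; apply/eqP; apply: contraTT jI => ne.
  rewrite -qj; have [->//|qp] := eqVneq q p.
  by have [_ _ [->|/noniso]] := ch' q qp ne.
(* If only the owner gave up pages, the fixed total leaves its mass as before the request; it was
   already non-tight, and the old ordering applies. *)
- move=> q q' qU q'U fq nt; have [//|[q'i un]] := ord q q' qU q'U fq nt.
  have mi : mass z (owner p) = mass (yval s) (owner p).
    apply: (mass_rest H zs) => j ji; apply: eq_mass => q'' q''j.
    rewrite un; last by rewrite q''j; apply/eqP.
    by rewrite loadE //; apply: contraNneq ji => <-; rewrite q''j.
  have nt_y : non_tight (yval s) (owner q') by move: nt; rewrite !non_tightE q'i mi.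
  have [qi|/eqP qi] := eqVneq (owner q) (owner p).
    by rewrite (lev q q') // q'i.
  rewrite un //; move: qU q'U; rewrite !in_unmarked_mark => /andP[qp qU] /andP[q'p q'U].
  rewrite loadE //; have /andP[le _] := bd' q' q'p.
  by apply: le_trans le; apply: (inv_ordered H).
- move=> yp1 q qp /(ch' q qp)[qU q1 own]; have pU := stale_unm yp1.
  case: own => [qi|nt]; first by rewrite (inv_levelled H pU qU).
  (* Agents in [G] have all unmarked pages at 1, so the owner of [p] is not among them. *)
  apply: (inv_ordered H) => //; rewrite finset.in_setU negb_or iI /=.
  by apply/negP => /(inv_released H)[_ _ /(_ p pU erefl) e]; rewrite e ltxx in yp1.
(* For an owner outside [G] the ordering would put every unmarked page of a non-tight agent at 1,
   against [servable]. *)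
- move=> yp1 pU; case: serv => [/eqP|iI'|[q [qU q1 own]]].
  + by rewrite (negPf yp0).
  + by rewrite iI' in iI.
  case: own => [qi|nt].
    by move: q1; rewrite (inv_levelled H qU pU) // yp1 ltxx.
  apply: contraT => iG; move: q1; rewrite ltNge -yp1 (inv_ordered H) //.
  by rewrite finset.in_setU negb_or iI.
- exists [set q in unmarked s | (yval s q < 1) && (owner q \notin isolated s)].
    exact: (inv_count H).
  move=> q qp /(ch' q qp)[qU q1 own]; rewrite in_sep qU q1 /=.
  by case: own => [->|/noniso].
Qed.

Lemma step_correct s G p : marking_inv s G -> exists G',
  [/\ marking_inv (step s p) G', yval (step s p) p = 0,
      forall q, q != p -> yval s q <= yval (step s p) q &
      forall X, feasible X -> X p = 1 ->
      yval s p + Theta (step s p) G' X <= Theta s G X].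
Proof.
move=> H; rewrite /step; case: ifP => [over|/negbT not_over].
  have [G' [inv' p0 le pay]] := serve_correct (inv_end H over) (servable_end H over).
  exists G'; split=> // X Xf Xp.
  have X0 q : 0 <= X q by case: Xf => /(_ q)/andP[].
  apply: le_trans (pay X X0 Xp) _; rewrite /Theta lerD ?(Phi_end H over) //.
  rewrite ler_wpM2l ?(Psi_end H over) //; have := ratio_ge1; lra.
have serv : servable s p.
  move: not_over; rewrite !negb_and !negbK => /or3P[/eqP|iI|].
  - by move=> e; apply: Or31.
  - exact: Or32.
  rewrite negb_forall => /existsP[q]; rewrite negb_imply negbK => /and3P[qU q1 own].
  by apply: Or33; exists q; split=> //; case/orP: own => [/eqP|]; [left|right].
have [G' [inv' p0 le pay]] := serve_correct H serv.
exists G'; split=> // X Xf Xp; apply: pay => // q.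
by case: Xf => /(_ q)/andP[].
Qed.

Lemma inv_init (C0 : {set page S}) : initial_cache C0 ->
  marking_inv (@init R S C0) finset.set0.
Proof.
case=> card res.
have unmE q : (q \in unmarked (@init R S C0)) = (q \in C0).
  by rewrite !inE eqxx !andbT.
have y0 q : q \in C0 -> yval (@init R S C0) q = 0 by move=> qC; rewrite ffunE qC.
have y1 q : q \notin C0 -> yval (@init R S C0) q = 1.
  by move=> qC; rewrite ffunE (negPf qC).
have low q : yval (@init R S C0) q < 1 -> q \in C0.
  by apply: contraTT => /y1 ->; rewrite ltxx.
have count (B : {set page S}) : B \subset C0 -> (#|B| <= k)%N.
  by move=> BC; rewrite -card subset_leq_card.
split.
- by move=> q; rewrite ffunE; case: ifP; rewrite ?lexx ?ler01.
- rewrite -card -cardsT -(cardsID C0 [set: page S]) finset.setTI natrD addrC addKr.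
  rewrite (bigID (mem C0)) /= big1 ?add0r => [|q /y0//].
  rewrite (eq_bigr (fun=> 1)) => [|q /y1//]; rewrite sumr_const; congr _%:R.
  by apply: eq_card => q; rewrite !inE andbT.
- by move=> q; rewrite inE.
- by move=> q /low; rewrite unmE; right.
- move=> j; rewrite (mass_zero_on_exact (A := C0)) // ?ler_nat //.
  by move=> q /y1.
- by move=> j; rewrite inE.
- by move=> q q'; rewrite !unmE => qC q'C _; rewrite !y0.
- move=> q q'; rewrite !unmE => qC q'C _ _; rewrite !y0 //.
- by move=> j; rewrite inE.
- by apply: count; apply/fintype.subsetP => q; rewrite in_sep unmE => /andP[].
- by move=> j; apply: count; apply/fintype.subsetP => q; rewrite in_sep unmE => /andP[].
Qed.

Lemma Phi_init (C0 : {set page S}) : Phi (@init R S C0) = 0.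
Proof.
apply: big1 => q; rewrite !inE eqxx !andbT => qC.
by rewrite ffunE qC phi0.
Qed.

(** * Summing the amortised bound over the request sequence *)

Section Run.
Variables (C0 : {set page S}) (n : nat) (sigma : n.-tuple (page S)).
Hypothesis C0_init : initial_cache C0.
Notation run t := (foldl (@step R S) (init C0) (take t sigma)).
Notation A := (online_run (@marking_algorithm R S C0) sigma).

Lemma run_step t (tn : (t < n)%N) :
  run t.+1 = step (run t) (tnth sigma (Ordinal tn)).
Proof.
rewrite (take_nth (tnth sigma (Ordinal tn))) ?size_tuple // foldl_rcons.
by rewrite [in RHS](tnth_nth (tnth sigma (Ordinal tn))).
Qed.

Lemma run_inv t : (t <= n)%N -> exists G, marking_inv (run t) G.
Proof.
elim: t => [_|t IH tn]; first by rewrite take0; exists finset.set0; apply: inv_init.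
have [G H] := IH (ltnW tn); rewrite (run_step tn).
by have [G' []] := step_correct (tnth sigma (Ordinal tn)) H; exists G'.
Qed.

Lemma runE t q : A t q = 1 - yval (run t) q.
Proof. by rewrite /online_run ffunE. Qed.

Lemma run_solution : solution sigma A.
Proof.
split=> [t tn|[t tn]].
  have [G H] := run_inv tn; split.
  - by move=> q; rewrite runE; have := inv_bounds H q; lra.
  - under eq_bigr => q _ do rewrite runE.
    by rewrite sumrB sumr_const (inv_sum H); lra.
  - move=> j; under eq_bigr => q _ do rewrite runE.
    exact: (inv_mass H).
have [G H] := run_inv (ltnW tn).
have [G' [_ p0 le _]] := step_correct (tnth sigma (Ordinal tn)) H.
split=> [|q qp]; rewrite !runE (run_step tn) ?p0 ?subr0 //.
by have := le q qp; lra.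
Qed.

Lemma sum_prefix t (tn : (t < n)%N) (f : 'I_n -> R) :
  \sum_(u < n | (u < t.+1)%N) f u = f (Ordinal tn) + \sum_(u < n | (u < t)%N) f u.
Proof.
rewrite (bigD1 (Ordinal tn)) ?ltnS ?leqnn //=; congr (_ + _); apply: eq_bigl => u.
by rewrite -val_eqE /= ltnS; lia.
Qed.

Lemma run_potential (X : nat -> {ffun page S -> R}) t :
  solution sigma X -> (t <= n)%N ->
  exists2 G, marking_inv (run t) G &
  \sum_(u < n | (u < t)%N) (1 - A u (tnth sigma u)) + Theta (run t) G (X t) <=
  Theta (init C0) finset.set0 (X 0) +
  4 * ratio * \sum_(u < n | (u < t)%N) (1 - X u (tnth sigma u)).
Proof.
move=> [Xf Xs]; elim: t => [_|t IH tn].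
  rewrite take0; exists finset.set0; first exact: inv_init.
  by rewrite !big_pred0 // mulr0 addr0 add0r.
have [G H le] := IH (ltnW tn).
have [G' [H' _ _ pay]] := step_correct (tnth sigma (Ordinal tn)) H.
have [Xp Xq] := Xs (Ordinal tn).
exists G'; first by rewrite (run_step tn).
rewrite !(sum_prefix tn) runE (run_step tn) /=.
have := pay _ (Xf _ tn) Xp.
have Xp1 : X t (tnth sigma (Ordinal tn)) <= 1.
  by case: (Xf t (ltnW tn)) => /(_ (tnth sigma (Ordinal tn)))/andP[].
(* The offline solution moves first, in the old state of the algorithm; then the algorithm serves
   against [X t.+1]. *)
have mv := Psi_move (marked (run t)) (unmarked (run t)) (isolated (run t)) G Xp1 Xp Xq.
have K0 : 0 <= ratio by have := ratio_ge1; lra.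
have := ler_wpM2l K0 mv; move: le; rewrite /Theta; lra.
Qed.

Lemma run_competitive (X : nat -> {ffun page S -> R}) : solution sigma X ->
  cost sigma A <= 4 * ratio * cost sigma X + ratio * (4 * #|page S|%:R + k%:R).
Proof.
move=> Xs; have [G H] := run_potential Xs (leqnn n).
have all_lt (f : 'I_n -> R) : \sum_(u < n | (u < n)%N) f u = \sum_(u < n) f u.
  by apply: eq_bigl => u; rewrite ltn_ord.
rewrite !all_lt -/(cost _ _) -/(cost _ _) /Theta Phi_init add0r.
have X01 t : (t <= n)%N -> forall q, 0 <= X t q <= 1.
  by move=> tn q; case: Xs => /(_ t tn)[].
have K0 : 0 <= ratio by have := ratio_ge1; lra.
have := ler_wpM2l K0 (Psi_le (marked (@init R S C0)) (unmarked (@init R S C0))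
  (isolated (@init R S C0)) finset.set0 (X01 0 (leq0n n))).
have := ler_wpM2l K0 (Psi_ge (marked (run n)) (unmarked (run n)) (isolated (run n)) G
  (X01 n (leqnn n))).
have := Phi_ge0 H; lra.
Qed.

Lemma run_competitive_OPT :
  cost sigma A <= 4 * ratio * cost_OPT sigma + ratio * (4 * #|page S|%:R + k%:R).
Proof.
have K1 := ratio_ge1; have K0 : 0 < 4 * ratio by lra.
rewrite -lerBlDr -ler_pdivrMl //; apply: lb_le_inf.
  (* The set under the infimum must be nonempty; the run of the algorithm is itself a solution. *)
  by exists (cost sigma A); exists A => //; exact: run_solution.
move=> c [X Xs ->]; rewrite ler_pdivrMl //.
by have := run_competitive Xs; lra.
Qed.

Lemma cost_OPT_ge0 : 0 <= cost_OPT sigma :> R.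
Proof.
apply: lb_le_inf.
  by exists (cost sigma A); exists A => //; exact: run_solution.
move=> c [X [Xf _] ->]; apply: sumr_ge0 => u _; rewrite subr_ge0.
by case: (Xf u (ltnW (ltn_ord u))) => /(_ (tnth sigma u))/andP[].
Qed.

End Run.
End Step.

(** As [k >= 1], [ln (1 + k) >= ln 2] absorbs the constant 2. *)
Lemma ratio_le (R : realType) (S : setting) :
  4 * @ratio R S <= 4 * (2 / ln 2 + 1) * ln (1 + (cache_size S)%:R) :> R.
Proof.
have k1 : 1 <= (cache_size S)%:R :> R by rewrite ler1n cache_size_gt0.
have ln2 : 0 < ln 2 :> R by rewrite ln_gt0 // ltr1n.
have le2 : ln 2 <= ln (1 + (cache_size S)%:R) :> R.
  by rewrite ler_ln ?posrE; lra.
have lek : ln (cache_size S)%:R <= ln (1 + (cache_size S)%:R) :> R.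
  by rewrite ler_ln ?posrE; lra.
have : 2 <= 2 / ln 2 * ln (1 + (cache_size S)%:R) :> R.
  by rewrite mulrAC ler_pdivlMr // ler_pM2l.
rewrite /ratio; lra.
Qed.

Theorem theorem1 (R : realType) :
  exists C : R, forall S : setting, exists b : R,
  forall C0 : {set page S}, initial_cache C0 ->
  forall (n : nat) (sigma : n.-tuple (page S)),
  let A := online_run (@marking_algorithm R S C0) sigma in
  solution sigma A /\
  cost sigma A <= C * ln (1 + (cache_size S)%:R) * cost_OPT sigma + b.
Proof.
exists (4 * (2 / ln 2 + 1)) => S.
(* [ratio] times the width of the range [[- k, 4 |P|]] of [Psi]. *)
exists (@ratio R S * (4 * #|page S|%:R + (cache_size S)%:R)) => C0 C0_init n sigma /=.
split; first exact: run_solution.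
apply: le_trans (run_competitive_OPT sigma C0_init) _; rewrite lerD2r.
by rewrite ler_wpM2r ?ratio_le // (cost_OPT_ge0 sigma C0_init).
Qed.
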